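(* Let $f\colon \mathbb{R}^n \to \mathbb{R}$ be a locally Lipschitz function, $g\colon \mathbb{R}^n \to \mathbb{R}^m$ a locally Lipschitz mapping, and $C \subset \mathbb{R}^m$ a nonempty closed set. Let $S := \{x \in \mathbb{R}^n \mid g(x) \in C\}$ be nonempty and assume that $f_* := \inf_{g(x)\in C} f(x)$ is finite. Let the following two assumptions hold: (A1) the (MFCQ) is satisfied at every global minimum of $f$ on $S$; (A2) the inclusion $K_\infty(f,S) \subset (f_*, \infty)$ is valid. Then the following properties are equivalent: (i) for all $c$ sufficiently large, one has $\inf_{g(x)\in C} f(x) = \inf_{x\in\mathbb{R}^n}\{ f(x) + c\,\mathrm{dist}(g(x), C)\}$; (ii) there exists a constant $c_* > 0$ such that $\inf_{x\in\mathbb{R}^n}\{ f(x) + c_*\,\mathrm{dist}(g(x), C)\} > -\infty$. When these equivalent properties hold, one has for any $c > c_*$ that $$\mathrm{argmin}_{g(x)\in C} f(x) = \mathrm{argmin}_{\mathbb{R}^n}\{ f(x) + c\,\mathrm{dist}(g(x), C)\};$$ moreover, if $\overline{x}$ is a global minimizer for the problem of minimizing $f(x)$ subject to $g(x)\in C$, then there exists a vector $w \in N_C(g(\overline{x})) \cap \mathbb{B}$ satisfying the optimality condition $$0 \in \partial f(\overline{x}) + c\, \partial\langle w, g\rangle(\overline{x}).$$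
   Context: $\|\cdot\|$ is the Euclidean norm, $\mathbb{B}$ the closed unit ball centered at the origin, $\mathrm{dist}(y,\Omega) := \inf_{y'\in \Omega}\|y-y'\|$, and $\Pi_\Omega(y) := \{y' \in \Omega \mid \|y-y'\| = \mathrm{dist}(y,\Omega)\}$ (a set). Limiting (Mordukhovich) normal cone to a set $\Omega$ at $x\in\Omega$: $N_\Omega(x) := \mathrm{Lim\,sup}_{x'\to x}\,[\mathrm{cone}(x' - \Pi_\Omega(x'))]$, where $\mathrm{cone}$ denotes the conic hull and, for a set-valued map $F$, $\mathrm{Lim\,sup}_{x'\to x} F(x') := \{y \mid \exists x_k\to x,\ \exists y_k\in F(x_k),\ y_k\to y\}$. Limiting subdifferential of $h\colon\mathbb{R}^n\to\mathbb{R}\cup\{\infty\}$ at $x$ with $h(x)<\infty$: $\partial h(x) := \{u\in\mathbb{R}^n \mid (u,-1)\in N_{\mathrm{epi}\,h}(x,h(x))\}$, where $\mathrm{epi}\,h := \{(x,y)\in\mathbb{R}^n\times\mathbb{R} \mid h(x)\le y\}$. For $w\in\mathbb{R}^m$, $\langle w,g\rangle\colon\mathbb{R}^n\to\mathbb{R}$ is the function $x\mapsto\langle w,g(x)\rangle$. The (generalized) Mangasarian–Fromovitz constraint qualification (MFCQ) holds at $x\in S$ if there is no unit vector $w\in N_C(g(x))$ such that $0\in\partial\langle w,g\rangle(x)$. For $x\in\mathbb{R}^n\setminus S$ put $\nu(x) := \inf\|\lambda u+(1-\lambda)v\|$, the infimum being taken over all real numbers $\lambda\in(0,1)$ and all vectors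 $u\in\partial f(x)$, $v\in\partial\langle w,g\rangle(x)$ and $w\in\frac{g(x)-\Pi_C(g(x))}{\mathrm{dist}(g(x),C)}$. $K_\infty(f,S)$ is the set of all $t\in\mathbb{R}$ for which there exists a sequence $x_k\in\mathbb{R}^n\setminus S$ such that $\|x_k\|\to\infty$, $\|x_k\|\,\nu(x_k)\to0$, $f(x_k)\to t$ and $\mathrm{dist}(g(x_k),C)\to0$ as $k\to\infty$. $\mathrm{argmin}$ denotes the set of global minimizers (possibly empty).
   Formalization: In the final part, c_* is taken to be a constant as in (ii) for which the equality of infima in (i) also holds for every c > c_* (such c_* is shown to exist); for an arbitrary c_* as in (ii) the claim fails, e.g. f(x) = -10 min(x,1), g(x) = x, C = (-∞,0], c_* = 1, c = 2. *)

(* Defs.v *)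
From HB Require Import structures.
From mathcomp Require Import all_boot all_order all_algebra.
From mathcomp Require Import all_classical all_reals all_analysis.

Set Implicit Arguments.
Unset Strict Implicit.
Unset Printing Implicit Defensive.

Import Order.TTheory GRing.Theory Num.Theory.
Import numFieldNormedType.Exports.

Local Open Scope classical_set_scope.
Local Open Scope ring_scope.

(* R^k is ['rV[R]_k].  The library norm [`|x|] on ['rV[R]_k] is the sup norm, so
   the Euclidean norm is defined here; the library topology on ['rV[R]_k] (used
   below for limits and closedness) is the usual one. *)
Definition dotp (R : realType) (k : nat) (x y : 'rV[R]_k) : R :=
  \sum_(i < k) x 0 i * y 0 i.

Definition enorm (R : realType) (k : nat) (x : 'rV[R]_k) : R :=
  Num.sqrt (dotp x x).

(* The real-valued [inf] is the true infimum only for nonempty [A]. *)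
Definition dist (R : realType) (k : nat) (A : set 'rV[R]_k) (y : 'rV[R]_k) : R :=
  inf [set enorm (y - y') | y' in A].

Definition proj (R : realType) (k : nat) (A : set 'rV[R]_k) (y : 'rV[R]_k) :
    set 'rV[R]_k :=
  [set y' | A y' /\ enorm (y - y') = dist A y].

(* No convexification is involved: the cone consists of the nonnegative
   multiples of single elements of [A]. *)
Definition conic_hull (R : realType) (k : nat) (A : set 'rV[R]_k) :
    set 'rV[R]_k :=
  [set v | exists a z, [/\ 0 <= a, A z & v = a *: z]].

Definition Limsup (R : realType) (k l : nat)
    (F : 'rV[R]_k -> set 'rV[R]_l) (x : 'rV[R]_k) : set 'rV[R]_l :=
  [set y | exists (x_ : nat -> 'rV[R]_k) (y_ : nat -> 'rV[R]_l),
     [/\ x_ i @[i --> \oo] --> x,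
         forall i, F (x_ i) (y_ i)
       & y_ i @[i --> \oo] --> y]].

(* Limiting (Mordukhovich) normal cone, empty at points outside [A]. *)
Definition normal_cone (R : realType) (k : nat) (A : set 'rV[R]_k)
    (x : 'rV[R]_k) : set 'rV[R]_k :=
  [set v | A x /\
     Limsup (fun x' => conic_hull [set x' - p | p in proj A x']) x v].

(* The pair (x, y) in R^k x R is encoded as a vector of R^(k+1), so that the
   norm on the product is again the Euclidean one. *)
Definition pair_mx (R : realType) (k : nat) (x : 'rV[R]_k) (y : R) :
    'rV[R]_(k + 1) :=
  row_mx x y%:M.

Definition epi (R : realType) (k : nat) (h : 'rV[R]_k -> \bar R) :
    set 'rV[R]_(k + 1) :=
  [set z | exists x y, (h x <= y%:E)%E /\ z = pair_mx x y].

(* For [h] with values in R u {+oo}; where [h x = +oo], the point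
   [pair_mx x 0] is not in [epi h] and the subdifferential is empty. *)
Definition subdiff_ext (R : realType) (k : nat) (h : 'rV[R]_k -> \bar R)
    (x : 'rV[R]_k) : set 'rV[R]_k :=
  [set u | normal_cone (epi h) (pair_mx x (fine (h x))) (pair_mx u (- 1))].

Definition subdiff (R : realType) (k : nat) (h : 'rV[R]_k -> R) :
    'rV[R]_k -> set 'rV[R]_k :=
  subdiff_ext (fun x => (h x)%:E).

(* [lipschitz ...] refers to the library norms; by equivalence of norms in
   finite dimension the notion does not depend on them. *)
Definition locally_lipschitz (R : realType) (V W : normedModType R)
    (h : V -> W) : Prop :=
  forall x : V, exists2 U : set V, nbhs x U & [lipschitz h y | y in U].

Definition argmin (R : realType) (T : Type) (A : set T) (h : T -> R) : set T :=
  [set x | A x /\ forall y, A y -> h x <= h y].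

(* Infimum in [-oo, +oo]. *)
Definition infval (R : realType) (T : Type) (A : set T) (h : T -> R) : \bar R :=
  ereal_inf [set (h x)%:E | x in A].

Section ConstrainedProblem.
Variables (R : realType) (n m : nat).
Variables (f : 'rV[R]_n -> R) (g : 'rV[R]_n -> 'rV[R]_m) (C : set 'rV[R]_m).

Definition feasible : set 'rV[R]_n := [set x | C (g x)].

Definition scalarization (w : 'rV[R]_m) (x : 'rV[R]_n) : R := dotp w (g x).

Definition MFCQ (x : 'rV[R]_n) : Prop :=
  ~ exists w, [/\ enorm w = 1, normal_cone C (g x) w
                & subdiff (scalarization w) x 0].

Definition nu (x : 'rV[R]_n) : \bar R :=
  ereal_inf [set r | exists (lam : R) (u v : 'rV[R]_n) (w : 'rV[R]_m),
    [/\ 0 < lam < 1,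
        subdiff f x u,
        [set (dist C (g x))^-1 *: (g x - p) | p in proj C (g x)] w,
        subdiff (scalarization w) x v
      & r = (enorm (lam *: u + (1 - lam) *: v))%:E]].

Definition K_infty : set R :=
  [set t | exists x_ : nat -> 'rV[R]_n,
    [/\ forall k, ~ feasible (x_ k),
        enorm (x_ k) @[k --> \oo] --> +oo%R,
        ((enorm (x_ k))%:E * nu (x_ k))%E @[k --> \oo] --> (0 : R)%:E,
        f (x_ k) @[k --> \oo] --> t
      & dist C (g (x_ k)) @[k --> \oo] --> (0 : R)]].

Definition penalty (c : R) (x : 'rV[R]_n) : R := f x + c * dist C (g x).

(* The constant c_* of the theorem.  Boundedness at [cs] alone does not suffice for
   the minimizers to agree for every c > [cs]: take f x = - 10 * min(x, 1), g x = x,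
   C = ]-oo, 0], [cs] = 1 and c = 2.  So [cs] must also bound from below the
   "sufficiently large" parameters for which the optimal values agree. *)
Definition penalty_threshold (cs : R) : Prop :=
  [/\ 0 < cs, (-oo < infval setT (penalty cs))%E
    & forall c, cs < c -> infval feasible f = infval setT (penalty c)].

End ConstrainedProblem.

(* Main.v *)
Require Import Defs.
From HB Require Import structures.
From mathcomp Require Import all_boot all_order all_algebra.
From mathcomp Require Import all_classical all_reals all_analysis.
From mathcomp Require Import ring lra.
Import Order.TTheory GRing.Theory Num.Theory.
Import numFieldNormedType.Exports.
Local Open Scope classical_set_scope.
Local Open Scope ring_scope.

Set Implicit Arguments.
Unset Strict Implicit.
Unset Printing Implicit Defensive.

(** Write F_c = f + c dist(g, C), S for the feasible set and f* for the optimal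
    value, and call v an approximate subgradient of h at y when
    h z >= h y + <v, z - y> - e |z - y| for z near y.

    Everything rests on a description of the limiting subdifferential that does
    not mention the epigraph: for locally Lipschitz h, v belongs to the
    subdifferential at x iff, for every e > 0, v is an approximate subgradient
    with error e at some point within e of x ([approx_subgrad_subdiff] and
    [subdiff_approx_subgrad]).  It makes the subdifferential visibly stable under
    perturbation of the point, of the vector and, by a small Lipschitz
    perturbation, of the function ([subdiff_stable]); in particular the
    subdifferential of <w, g> is closed jointly in (x, w).  It also reduces the
    sum rule to decoupling the variables by a quadratic penalty
    ([fuzzy_sum_rule], [limiting_sum_rule]).

    No chain rule for dist(g, C) is needed.  If p is a projection of g(x) on C,
    then dist(g(z), C) <= |g(z) - p| for all z with equality at z = x, so a local
    minimizer x of F_c stays one when the distance to C is replaced by the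
    distance to p.  Off S the latter is smooth in g, so linearizing it leaves a
    local minimizer of f + c <w, g> up to an arbitrarily small multiple of
    |z - x|, where w is the unit vector along g(x) - p.  Replacing the distance d
    by the square root of d^2 + del^2 makes the same argument work at feasible
    points ([smoothed_penalty_stationary]).

    Exactness from boundedness.  Suppose that F_cs is bounded below by B and that
    inf F_c < f* for all c.  For c large take a with F_c(a) < f* and minimize
    F_c + eps |z - a| with eps = (f* - B) / (1 + |a|).  The minimizer x lies in
    the ball of radius 1 + |a| about a, still satisfies F_c(x) < f*, hence is
    infeasible, and is stationary up to 2 eps while eps |x| <= 2 (f* - B)
    ([penalty_critical_exists]).  So |x| nu(x) is O(1/c), and (c - cs)
    dist(g(x), C) <= f* - B forces dist(g(x), C) to 0 as c grows.  If these points
    escape to infinity, a limit t <= f* of the values f(x) lies in K_infty,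
    against (A2) ([unbounded_critical_K_infty]).  Otherwise they cluster at a
    point of S with value at most f*, a global minimizer; dividing the
    stationarity relation by c shows that it violates (A1)
    ([bounded_critical_not_MFCQ]).

    Optimality condition.  A global minimizer xbar of F_c is approached, as del
    tends to 0, by the minimizers of the smoothed penalty plus |z - xbar|^2 on the
    unit ball about xbar.  These are stationary in the sense above, with w in the
    cone generated by g(x) - p and |w| <= 1, and the relation passes to the limit
    ([penalty_minimizer_optimality]). *)

(** * Euclidean norm and the topology of row vectors *)

Section Euclid.
Context {R : realType} {k : nat}.
Implicit Types x y z : 'rV[R]_k.

Lemma dotpC x y : dotp x y = dotp y x.
Proof. by apply: eq_bigr => i _; rewrite mulrC. Qed.

Lemma dotpDl x y z : dotp (x + y) z = dotp x z + dotp y z.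
Proof. by rewrite -big_split; apply: eq_bigr => i _; rewrite mxE mulrDl. Qed.

Lemma dotpZl a x y : dotp (a *: x) y = a * dotp x y.
Proof. by rewrite mulr_sumr; apply: eq_bigr => i _; rewrite mxE mulrA. Qed.

Lemma dotpNl x y : dotp (- x) y = - dotp x y.
Proof. by rewrite -scaleN1r dotpZl mulN1r. Qed.

Lemma dotpBl x y z : dotp (x - y) z = dotp x z - dotp y z.
Proof. by rewrite dotpDl dotpNl. Qed.

Lemma dotpDr x y z : dotp x (y + z) = dotp x y + dotp x z.
Proof. by rewrite !(dotpC x) dotpDl. Qed.

Lemma dotpZr a x y : dotp x (a *: y) = a * dotp x y.
Proof. by rewrite !(dotpC x) dotpZl. Qed.

Lemma dotpNr x y : dotp x (- y) = - dotp x y.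
Proof. by rewrite !(dotpC x) dotpNl. Qed.

Lemma dotpBr x y z : dotp x (y - z) = dotp x y - dotp x z.
Proof. by rewrite dotpDr dotpNr. Qed.

Lemma dotp0l x : dotp 0 x = 0.
Proof. by rewrite -(scale0r 0) dotpZl mul0r. Qed.

Lemma dotp_ge0 x : 0 <= dotp x x.
Proof. by apply: sumr_ge0 => i _; rewrite -expr2 sqr_ge0. Qed.

Lemma enorm_ge0 x : 0 <= enorm x.
Proof. exact: sqrtr_ge0. Qed.

Lemma sqr_enorm x : enorm x ^+ 2 = dotp x x.
Proof. by rewrite sqr_sqrtr // dotp_ge0. Qed.

Lemma le_coord_enorm x i : `|x 0 i| <= enorm x.
Proof.
rewrite -sqrtr_sqr ler_wsqrtr // expr2 /dotp (bigD1 i) //= lerDl.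
by apply: sumr_ge0 => j _; rewrite -expr2 sqr_ge0.
Qed.

Lemma enorm0_eq0 x : enorm x = 0 -> x = 0.
Proof.
move=> x0; apply/rowP => i; rewrite mxE; apply/normr0_eq0/eqP.
by rewrite eq_le normr_ge0 andbT -x0 le_coord_enorm.
Qed.

Lemma enorm0 : enorm (0 : 'rV[R]_k) = 0.
Proof. by rewrite /enorm dotp0l sqrtr0. Qed.

Lemma enormN x : enorm (- x) = enorm x.
Proof. by rewrite /enorm dotpNl dotpNr opprK. Qed.

Lemma enormBC x y : enorm (x - y) = enorm (y - x).
Proof. by rewrite -enormN opprB. Qed.

Lemma enormZ a x : enorm (a *: x) = `|a| * enorm x.
Proof.
by rewrite /enorm dotpZl dotpZr mulrA -expr2 sqrtrM ?sqr_ge0 // sqrtr_sqr.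
Qed.

Lemma dotp_le x y : dotp x y <= enorm x * enorm y.
Proof.
have [x0|xN0] := eqVneq (enorm x) 0.
  by rewrite (enorm0_eq0 x0) dotp0l enorm0 mul0r.
have [y0|yN0] := eqVneq (enorm y) 0.
  by rewrite (enorm0_eq0 y0) dotpC dotp0l enorm0 mulr0.
have xp : 0 < enorm x by rewrite lt_def xN0 enorm_ge0.
have yp : 0 < enorm y by rewrite lt_def yN0 enorm_ge0.
have := dotp_ge0 (enorm y *: x - enorm x *: y).
rewrite !(dotpBl, dotpBr, dotpZl, dotpZr) -!sqr_enorm (dotpC y x) => H.
have xyp : 0 < enorm x * enorm y by exact: mulr_gt0.
nra.
Qed.

Lemma dotp_ge x y : - (enorm x * enorm y) <= dotp x y.
Proof. by rewrite lerNl -dotpNl -(enormN x) dotp_le. Qed.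

Lemma ler_enormD x y : enorm (x + y) <= enorm x + enorm y.
Proof.
rewrite -(@ler_pXn2r _ 2) ?nnegrE ?addr_ge0 ?enorm_ge0 //.
rewrite sqr_enorm dotpDl !dotpDr -!sqr_enorm (dotpC y x).
have := dotp_le x y; nra.
Qed.

Lemma ler_enormB x y : enorm (x - y) <= enorm x + enorm y.
Proof. by rewrite -(enormN y) ler_enormD. Qed.

Lemma ler_enorm_dist y x z : enorm (x - z) <= enorm (x - y) + enorm (y - z).
Proof. by rewrite -(subrKA y) ler_enormD. Qed.

Lemma ler_enorm_sub x y : enorm x <= enorm y + enorm (x - y).
Proof. by rewrite -{1}(subrK y x) addrC ler_enormD. Qed.

(** With [norm_le_enorm], the equivalence of the Euclidean norm with the sup norm
    that carries the topology; the constant is crude. *)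
Lemma enorm_le_norm x : enorm x <= k%:R * `|x|.
Proof.
rewrite -(@ler_pXn2r _ 2) ?nnegrE ?enorm_ge0 ?mulr_ge0 //.
rewrite sqr_enorm exprMn; apply: (@le_trans _ _ (\sum_(i < k) `|x| ^+ 2)).
  apply: ler_sum => i _; rewrite -expr2 -real_normK ?num_real //.
  by rewrite ler_pXn2r ?nnegrE // [leRHS]mx_normrE; apply: le_bigmax (0, i).
rewrite sumr_const card_ord -[leLHS]mulr_natl ler_wpM2r ?sqr_ge0 //.
by rewrite -natrX ler_nat -mulnn; case: (k) => // j; rewrite leq_pmulr.
Qed.

Lemma norm_le_enorm x : `|x| <= enorm x.
Proof.
rewrite [leLHS]mx_normrE; apply: bigmax_le; first exact: enorm_ge0.
by case=> i j _ /=; rewrite ord1 le_coord_enorm.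
Qed.

Lemma nbhs_enormP x (U : set 'rV[R]_k) :
  nbhs x U <-> exists2 e, 0 < e & forall y, enorm (y - x) < e -> U y.
Proof.
split.
  move=> /(nbhs_normP (V := 'rV[R]_k))[e /= e0 eU]; exists e => // y yx.
  apply: eU => /=.
  by rewrite /ball_ /= distrC (le_lt_trans (norm_le_enorm _)).
move=> [e e0 eU]; apply/(nbhs_normP (V := 'rV[R]_k)); exists (e / (k%:R + 1)) => /=.
  by rewrite divr_gt0 // ltr_wpDl.
move=> y /=; rewrite ltr_pdivlMr ?ltr_wpDl // distrC => yx; apply: eU.
apply: le_lt_trans (enorm_le_norm _) _; apply: le_lt_trans yx.
by rewrite mulrC ler_wpM2l // lerDl.
Qed.

Lemma near_enorm x e : 0 < e -> \forall z \near x, enorm (z - x) < e.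
Proof. by move=> e0; apply/nbhs_enormP; exists e. Qed.

Lemma cvg_enormP (u : nat -> 'rV[R]_k) x :
  (forall e, 0 < e -> \forall i \near \oo, enorm (u i - x) < e) <->
  u i @[i --> \oo] --> x.
Proof.
split=> [H U /nbhs_enormP[e e0 eU] | H e e0].
  by have := H _ e0; apply: filterS => i; apply: eU.
exact: (H _ (near_enorm x e0)).
Qed.

Lemma continuous_enorm (h : 'rV[R]_k -> R) x e : continuous h -> 0 < e ->
  exists2 d, 0 < d & forall y, enorm (y - x) < d -> `|h x - h y| < e.
Proof.
move=> hc e0; apply/(nbhs_enormP x (fun y => `|h x - h y| < e)).
exact: (cvgr_dist_lt _ _ (hc x) _ e0).
Qed.

Lemma enorm_lip_continuous (h : 'rV[R]_k -> R) (L : R) :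
  (forall x y, `|h x - h y| <= L * enorm (x - y)) -> continuous h.
Proof.
move=> hL x; apply/(@cvgrPdist_lt _ _ _ _ (nbhs_filter x)) => e e0.
have d0 : 0 < e / (`|L| + 1) by rewrite divr_gt0 // ltr_wpDl.
apply: filterS (near_enorm x d0) => z.
rewrite ltr_pdivlMr ?ltr_wpDl // mulrC => zx.
apply: le_lt_trans (hL _ _) _; apply: le_lt_trans zx; rewrite enormBC.
by rewrite ler_wpM2r ?enorm_ge0 //; have := ler_norm L; lra.
Qed.

Lemma ler_dist_enorm x y z : `|enorm (x - z) - enorm (y - z)| <= enorm (x - y).
Proof.
have := ler_enorm_dist y x z; have := ler_enorm_dist x y z.
by rewrite (enormBC y x) ler_norml; lra.
Qed.

Lemma enormB_continuous x : continuous (fun y : 'rV[R]_k => enorm (y - x)).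
Proof.
apply: (@enorm_lip_continuous _ 1) => y z.
by rewrite mul1r ler_dist_enorm.
Qed.

Lemma enorm_ball_compact x r : compact [set y | enorm (y - x) <= r].
Proof.
apply: bounded_closed_compact.
  exists (r + enorm x); split; first exact: num_real.
  move=> M rM y /= yx; apply: le_trans (norm_le_enorm _) _.
  by have := ler_enorm_sub y x; lra.
apply: (@closed_comp _ _ (fun y => enorm (y - x)) [set t | t <= r]).
  by move=> y _; exact: enormB_continuous.
exact: closed_le.
Qed.

End Euclid.

(** Phrased with neighborhoods rather than subsequences: every limit passage
    below only asks for some late index where finitely many quantities are
    close to their limits. *)
Lemma compact_seq_cluster {T : topologicalType} (K : set T) (s : nat -> T) :
  compact K -> (forall i, K (s i)) ->
  exists l : T, forall U, nbhs l U -> forall N, exists2 i, (N <= i)%N & U (s i).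
Proof.
move=> Kc Ks; have [|l [_ lc]] := Kc (s i @[i --> \oo]) _.
  by exists 0%N => // i _; exact: Ks.
exists l => U lU N.
have [] := lc [set s i | i in [set i | (N <= i)%N]] U _ lU.
  by exists N => // i /= Ni; exists i.
by move=> _ [[i Ni <-] Ui]; exists i.
Qed.

(** * Distance and projection *)

Section Distance.
Context {R : realType} {k : nat}.
Implicit Types (A : set 'rV[R]_k) (x y a : 'rV[R]_k).

Lemma closed_enorm A x :
  closed A -> (forall e, 0 < e -> exists2 a, A a & enorm (a - x) < e) -> A x.
Proof.
move=> Acl Ax; apply: Acl => U /nbhs_enormP[e e0 eU].
by have [a Aa ax] := Ax _ e0; exists a; split => //; apply: eU.
Qed.

Lemma closed_enorm_intro A :
  (forall x, (forall e, 0 < e -> exists2 a, A a & enorm (a - x) < e) -> A x) ->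
  closed A.
Proof.
move=> H x Ax; apply: H => e e0.
by have [a [Aa ax]] := Ax _ (near_enorm x e0); exists a.
Qed.

Lemma dist_le A y a : A a -> dist A y <= enorm (y - a).
Proof.
move=> Aa; apply: ge_inf; last by exists a.
by exists 0 => _ [b _ <-]; exact: enorm_ge0.
Qed.

Lemma dist_ge0 A y : A !=set0 -> 0 <= dist A y.
Proof.
case=> a Aa; apply: lb_le_inf; first by exists (enorm (y - a)), a.
by move=> _ [b _ <-]; exact: enorm_ge0.
Qed.

Lemma proj_neq0 A y : closed A -> A !=set0 -> Defs.proj A y !=set0.
Proof.
move=> Acl [a Aa].
pose K := A `&` [set z | enorm (z - y) <= enorm (a - y)].
have Kc : compact K.
  rewrite /K setIC; apply: compact_closedI => //; exact: enorm_ball_compact.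
have Ka : K a by split => //=.
have [||p] := @EVT_min_rV _ _ (fun z => enorm (z - y)) K _ Kc.
- by exists a.
- by apply: continuous_subspaceT; exact: enormB_continuous.
move=> /set_mem[Ap py] pmin; exists p; split => //.
apply/eqP; rewrite eq_le dist_le // andbT.
apply: lb_le_inf; first by exists (enorm (y - a)), a.
move=> _ [b Ab <-]; rewrite !(enormBC y).
have [ba|/ltW ab] := leP (enorm (b - y)) (enorm (a - y)); last first.
  exact: le_trans ab.
by apply: pmin; apply/mem_set.
Qed.

Lemma dist_lip A x y :
  closed A -> A !=set0 -> `|dist A x - dist A y| <= enorm (x - y).
Proof.
move=> Acl A0; have [p [Ap px]] := proj_neq0 x Acl A0.
have [q [Aq qy]] := proj_neq0 y Acl A0.
have := dist_le x Aq; have := dist_le y Ap.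
have := ler_enorm_dist y x q; have := ler_enorm_dist x y p.
by rewrite px qy (enormBC y x) ler_norml; lra.
Qed.

Lemma dist_eq0 A y : closed A -> A !=set0 -> dist A y = 0 -> A y.
Proof.
move=> Acl A0 d0; have [p [Ap py]] := proj_neq0 y Acl A0.
by move: py; rewrite d0 => /enorm0_eq0/subr0_eq ->.
Qed.

Lemma dist_mem A y : A y -> dist A y = 0.
Proof.
move=> Ay; apply/eqP; rewrite eq_le dist_ge0; last by exists y.
by rewrite andbT; have := dist_le y Ay; rewrite subrr enorm0.
Qed.

(** Expanding |z - p|^2 <= |z - q|^2 about p: the vector z - p is a proximal
    normal at p, without any convexity of the set. *)
Lemma proj_sq A z p q :
  Defs.proj A z p -> A q -> 2 * dotp (z - p) (q - p) <= dotp (q - p) (q - p).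
Proof.
move=> [Ap zp] Aq; have := dist_le z Aq; rewrite -zp => H.
have : dotp (z - p) (z - p) <= dotp (z - q) (z - q).
  by rewrite -!sqr_enorm ler_pXn2r ?nnegrE ?enorm_ge0.
have -> : z - q = (z - p) - (q - p) by rewrite opprB addrA subrK.
move: (z - p) (q - p) => u v.
by rewrite !(dotpBl, dotpBr) (dotpC v u); lra.
Qed.

End Distance.

Lemma near_invS_lt {R : realType} (e : R) :
  0 < e -> \forall i \near \oo, i.+1%:R^-1 < e.
Proof. by move=> e0; exact: (near_infty_natSinv_lt (PosNum e0)). Qed.

(** Trades the two sequences of the definition for a closeness statement, which
    is both easier to establish and easier to use. *)
Lemma LimsupP (R : realType) (k l : nat)
    (F : 'rV[R]_k -> set 'rV[R]_l) (x : 'rV[R]_k) (v : 'rV[R]_l) :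
  Limsup F x v <->
  forall e, 0 < e ->
    exists x' y, [/\ enorm (x' - x) < e, F x' y & enorm (y - v) < e].
Proof.
split=> [[x_ [y_ [/cvg_enormP x_x Fxy /cvg_enormP y_v]]] e e0|H].
  have [i [xi yi]] := filter_ex (filterI (x_x _ e0) (y_v _ e0)).
  by exists (x_ i), (y_ i).
have /choice[s sP] : forall i : nat, exists p : 'rV[R]_k * 'rV[R]_l,
    [/\ enorm (p.1 - x) < i.+1%:R^-1, F p.1 p.2 & enorm (p.2 - v) < i.+1%:R^-1].
  move=> i; have [|x' [y []]] := H i.+1%:R^-1; first by rewrite invr_gt0.
  by exists (x', y).
exists (fun i => (s i).1), (fun i => (s i).2); split.
- apply/cvg_enormP => e e0; apply: filterS (near_invS_lt e0) => i.
  by apply: lt_trans; case: (sP i).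
- by move=> i; case: (sP i).
- apply/cvg_enormP => e e0; apply: filterS (near_invS_lt e0) => i.
  by apply: lt_trans; case: (sP i).
Qed.

(** * Local Lipschitz continuity in Euclidean terms *)

Lemma locally_lipschitz_enorm (R : realType) (k : nat) (W : normedModType R)
    (h : 'rV[R]_k -> W) :
  locally_lipschitz h -> forall x, exists L r, [/\ 0 < L, 0 < r &
    forall y z, enorm (y - x) <= r -> enorm (z - x) <= r ->
      `|h y - h z| <= L * enorm (y - z)].
Proof.
move=> hL x; have [U /nbhs_enormP[e e0 eU] [M [_ ML]]] := hL x.
exists (`|M| + 1), (e / 2); split; [by rewrite ltr_wpDl | by rewrite divr_gt0 |].
move=> y z yx zx; have MM : M < `|M| + 1 by have := ler_norm M; lra.
apply: le_trans (ML _ MM (y, z) _) _.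
  by split; apply: eU; lra.
by rewrite ler_wpM2l ?addr_ge0 //= norm_le_enorm.
Qed.

Lemma locally_lipschitz_continuous (R : realType) (k : nat)
    (h : 'rV[R]_k -> R) :
  locally_lipschitz h -> continuous h.
Proof.
move=> hL x; have [L [r [L0 r0 hLr]]] := locally_lipschitz_enorm hL x.
apply/(@cvgrPdist_lt _ _ _ _ (nbhs_filter x)) => e e0.
have d0 : 0 < Num.min r (e / L) by rewrite lt_min r0 divr_gt0.
apply: filterS (near_enorm x d0) => z.
rewrite lt_min ltr_pdivlMr // => /andP[zr zx].
apply: le_lt_trans (hLr _ _ _ _) _; first by rewrite subrr enorm0 ltW.
  exact: ltW.
by rewrite mulrC enormBC.
Qed.

Lemma locally_lipschitz_enorm_vec (R : realType) (k l : nat)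
    (h : 'rV[R]_k -> 'rV[R]_l) :
  locally_lipschitz h -> forall x, exists L r, [/\ 0 < L, 0 < r &
    forall y z, enorm (y - x) <= r -> enorm (z - x) <= r ->
      enorm (h y - h z) <= L * enorm (y - z)].
Proof.
move=> hL x; have [L [r [L0 r0 hLr]]] := locally_lipschitz_enorm hL x.
exists ((l%:R + 1) * L), r; split => //; first by rewrite mulr_gt0 ?ltr_wpDl.
move=> y z yx zx; apply: le_trans (enorm_le_norm _) _.
rewrite -mulrA; apply: ler_pM => //; first by rewrite lerDl.
exact: hLr.
Qed.

(** * Epigraphs *)

Section Pairs.
Context {R : realType} {k : nat}.
Implicit Types (x y : 'rV[R]_k) (a b : R).

Lemma pair_mxB x y a b : pair_mx x a - pair_mx y b = pair_mx (x - y) (a - b).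
Proof. by rewrite /pair_mx opp_row_mx add_row_mx raddfB. Qed.

Lemma pair_mxP (z : 'rV[R]_(k + 1)) : exists x a, z = pair_mx x a.
Proof.
exists (lsubmx z), (rsubmx z 0 0).
by rewrite /pair_mx -mx11_scalar hsubmxK.
Qed.

Lemma dotp_pair x y a b :
  dotp (pair_mx x a) (pair_mx y b) = dotp x y + a * b.
Proof.
rewrite /dotp big_split_ord /= big_ord1 !row_mxEr !mxE eqxx !mulr1n.
by congr (_ + _); apply: eq_bigr => i _; rewrite !row_mxEl.
Qed.

Lemma enorm_pair_ge_l x a : enorm x <= enorm (pair_mx x a).
Proof. by rewrite ler_wsqrtr // dotp_pair lerDl -expr2 sqr_ge0. Qed.

Lemma enorm_pair_ge_r x a : `|a| <= enorm (pair_mx x a).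
Proof.
by rewrite -sqrtr_sqr ler_wsqrtr // dotp_pair lerDr dotp_ge0.
Qed.

Lemma enorm_pair_le x a : enorm (pair_mx x a) <= enorm x + `|a|.
Proof.
rewrite -(@ler_pXn2r _ 2) ?nnegrE ?addr_ge0 ?enorm_ge0 //.
rewrite sqr_enorm dotp_pair sqrrD -sqr_enorm real_normK ?num_real // expr2.
have : 0 <= enorm x * `|a| by rewrite mulr_ge0 ?enorm_ge0.
rewrite -mulr_natl; lra.
Qed.

Lemma pair_mx_epi (h : 'rV[R]_k -> R) x a :
  epi (fun x => (h x)%:E) (pair_mx x a) <-> h x <= a.
Proof.
split=> [[y [b []]]|hxa]; last by exists x, a; rewrite lee_fin.
rewrite lee_fin => hyb /eq_row_mx[-> /(congr1 (fun M : 'M[R]_1 => M 0 0))].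
by rewrite !mxE !mulr1n => ->.
Qed.

Lemma epi_closed (h : 'rV[R]_k -> R) :
  continuous h -> closed (epi (fun x => (h x)%:E)).
Proof.
move=> hc; apply: closed_enorm_intro => z; have [x [a ->]] := pair_mxP z => H.
apply/pair_mx_epi; rewrite leNgt; apply/negP => hxa.
have d0 : 0 < (h x - a) / 2 by lra.
have [r r0 rP] := continuous_enorm x hc d0.
have m0 : 0 < Num.min r ((h x - a) / 2) by rewrite lt_min r0.
have [w] := H _ m0; have [y [b ->]] := pair_mxP w.
move=> /pair_mx_epi hyb; rewrite pair_mxB lt_min => /andP[yr br].
have := rP y (le_lt_trans (enorm_pair_ge_l _ _) yr).
have := le_lt_trans (enorm_pair_ge_r _ _) br.
rewrite !ltr_norml; lra.
Qed.

End Pairs.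

(** * The limiting subdifferential through approximate subgradients *)

Section Subgradients.
Context {R : realType} {k : nat}.
Implicit Types (h : 'rV[R]_k -> R) (x y v : 'rV[R]_k) (e : R).

(** The Frechet subgradient inequality with a fixed error [e] instead of little-o:
    no limit is hidden in it, and errors on [v] are absorbed in [e]. *)
Definition approx_subgrad h v e y : Prop :=
  \forall z \near y, h y + dotp v (z - y) - e * enorm (z - y) <= h z.

(** Move from (y, h y) by a small step t (v, -1) and project back on the epigraph.
    The approximate subgradient inequality bounds <(v, -1), p - q> by e |p - q|,
    where q = (y, h y), so the projection p lies within 2 t e of q: the step,
    divided by t, is a proximal normal within 2 e of (v, -1). *)
Lemma approx_subgrad_subdiff h x v : continuous h ->
  (forall e, 0 < e -> exists2 y, enorm (y - x) < e & approx_subgrad h v e y) ->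
  subdiff h x v.
Proof.
move=> hc H; split; first exact/pair_mx_epi.
apply/LimsupP => e e0 /=.
set V := pair_mx v (-1); set X := pair_mx x (h x).
have e40 : 0 < e / 4 by lra.
have [d d0 dP] := continuous_enorm x hc e40.
have [|y yx /nbhs_enormP[r r0 rP]] := H (Num.min d (e / 4)).
  by rewrite lt_min d0.
move: yx; rewrite lt_min => /andP[yd ye].
set e1 := Num.min d (e / 4) in rP.
have e10 : 0 < e1 by rewrite lt_min d0.
have e1e : e1 <= e / 4 by rewrite ge_min lexx orbT.
set q := pair_mx y (h y).
have qX : enorm (q - X) < e / 2.
  rewrite /q /X pair_mxB; apply: le_lt_trans (enorm_pair_le _ _) _.
  by have := dP _ yd; rewrite distrC; lra.
set N := enorm V; have N0 : 0 <= N := enorm_ge0 V.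
(* the step keeps the moved point close to [X], and its projection in the region
   where the subgradient inequality holds *)
have [t t0 [te tr]] : exists2 t, 0 < t & t * N < e / 2 /\ 2 * (t * N) < r.
  exists (Num.min (e / 2) (r / 2) / (N + 1)).
    by rewrite divr_gt0 ?lt_min ?divr_gt0 ?ltr_wpDl.
  set m := Num.min _ _.
  have m0 : 0 < m by rewrite lt_min !divr_gt0.
  have : m / (N + 1) * N < m.
    by rewrite mulrAC ltr_pdivrMr ?ltr_wpDl // ltr_pM2l // ltrDl.
  have : m <= e / 2 by rewrite ge_min lexx.
  have : m <= r / 2 by rewrite ge_min lexx orbT.
  by move=> ? ? ?; split; lra.
have [p pP] : Defs.proj (epi (fun x => (h x)%:E)) (q + t *: V) !=set0.
  by apply: proj_neq0; [exact: epi_closed | exists q; exact/pair_mx_epi].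
have qepi : epi (fun x => (h x)%:E) q by exact/pair_mx_epi.
have tV : enorm (t *: V) = t * N by rewrite enormZ gtr0_norm.
exists (q + t *: V), (t^-1 *: (q + t *: V - p)); split.
- rewrite addrAC; apply: le_lt_trans (ler_enormD _ _) _; rewrite tV; lra.
- by exists t^-1, (q + t *: V - p); split; [rewrite invr_ge0 ltW|exists p|].
have pq := proj_sq pP qepi.
have : enorm (p - q) <= 2 * (t * N).
  have := dist_le (q + t *: V) qepi; case: pP => _ <-.
  rewrite (addrC q) addrK tV.
  have := ler_enorm_dist (t *: V + q) p q; rewrite addrK tV (enormBC p (_ + _)); lra.
have -> : t^-1 *: (q + t *: V - p) - V = - (t^-1 *: (p - q)).
  rewrite -scalerN opprB addrAC scalerDr scalerA mulVf ?gt_eqF // scale1r.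
  by rewrite addrK.
rewrite enormN enormZ gtr0_norm ?invr_gt0 // => pqN.
have {}pq : dotp (p - q) (p - q) <= 2 * t * dotp V (p - q).
  move: pq; rewrite -(opprB p q).
  have -> : q + t *: V - p = t *: V - (p - q) by rewrite opprB [RHS]addrCA addrA.
  move: (p - q) => D; rewrite dotpBl !dotpNr dotpZl dotpNl; lra.
have [y' [r' pE]] := pair_mxP p.
have yr' : h y' <= r' by apply/pair_mx_epi; rewrite -pE; case: pP.
have VD : dotp V (p - q) <= e1 * enorm (p - q).
  have yy : enorm (y' - y) <= enorm (p - q).
    by rewrite pE pair_mxB enorm_pair_ge_l.
  have := rP y' (le_lt_trans yy (le_lt_trans pqN tr)).
  rewrite {1}pE /V /q pair_mxB dotp_pair.
  have : e1 * enorm (y' - y) <= e1 * enorm (p - q) by rewrite ler_wpM2l // ltW.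
  lra.
have D0 := enorm_ge0 (p - q).
(* divide |p - q|^2 <= 2 t <V, p - q> <= 2 t e1 |p - q| by |p - q| *)
have DD : enorm (p - q) <= 2 * t * e1.
  move: pq; rewrite -sqr_enorm; have [->|Dn] := eqVneq (enorm (p - q)) 0.
    by rewrite !mulr_ge0 // ltW.
  move=> pq; have Dp : 0 < enorm (p - q) by rewrite lt_def Dn.
  rewrite -(ler_pM2r Dp) -expr2; apply: le_trans pq _.
  by rewrite -[leRHS]mulrA ler_wpM2l // mulr_ge0 // ltW.
apply: le_lt_trans (_ : t^-1 * (2 * t * e1) < e).
  by rewrite ler_wpM2l // invr_ge0 ltW.
have -> : t^-1 * (2 * t * e1) = 2 * e1 by field; rewrite gt_eqF.
lra.
Qed.

(** A proximal normal (w, -s) of the epigraph close to (v, -1) has s close to 1.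
    Its foot is then on the graph, since a point strictly above could be lowered;
    and the quadratic error of the projection inequality, which involves
    h z - h y, is O(|z - y|^2) because h is Lipschitz.  Dividing by s gives a
    subgradient w / s close to v. *)
Lemma subdiff_approx_subgrad h x v : locally_lipschitz h -> subdiff h x v ->
  forall e, 0 < e -> exists2 y, enorm (y - x) < e & approx_subgrad h v e y.
Proof.
move=> hL [_ /LimsupP/= H] e e0.
have [L [r [L0 r0 hLr]]] := locally_lipschitz_enorm hL x.
have v0 : 0 < 1 + enorm v by rewrite ltr_wpDr ?enorm_ge0.
set X := pair_mx x (h x) in H; set V := pair_mx v (-1) in H.
have [e1 [e10 e1r e1e e1v e12]] : exists e1, [/\ 0 < e1, e1 <= r / 4, e1 <= e / 2,
    e1 * (1 + enorm v) <= e / 4 & e1 <= 1 / 2].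
  exists (Num.min (Num.min (r / 4) (e / 2)) (Num.min (e / 4 / (1 + enorm v)) (1 / 2))).
  split.
  - by rewrite !lt_min !divr_gt0.
  - by rewrite !ge_min lexx.
  - by rewrite !ge_min lexx !orbT.
  - by rewrite -ler_pdivlMr // !ge_min lexx !orbT.
  - by rewrite !ge_min lexx !orbT.
have [Z [_ [ZX [a [_ [a0 [p pP <-] ->]]]] YV]] := H _ e10.
have Xepi : epi (fun x => (h x)%:E) X by exact/pair_mx_epi.
have [y [b pE]] := pair_mxP p.
have yb : h y <= b by apply/pair_mx_epi; rewrite -pE; case: pP.
have yx : enorm (y - x) < 2 * e1.
  apply: le_lt_trans (_ : enorm (p - X) < _).
    by rewrite pE pair_mxB enorm_pair_ge_l.
  have := dist_le Z Xepi; case: pP => _ <-.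
  have := ler_enorm_dist Z p X; rewrite (enormBC p Z); lra.
have [w [s' YE]] := pair_mxP (a *: (Z - p)).
have [s sE] : exists s, s' = - s by exists (- s'); rewrite opprK.
rewrite {}sE {s'} in YE.
have wv : enorm (w - v) < e1.
  by apply: le_lt_trans YV; rewrite YE pair_mxB enorm_pair_ge_l.
have : `|- s - (-1)| < e1.
  by apply: le_lt_trans YV; rewrite YE pair_mxB enorm_pair_ge_r.
rewrite opprK ltr_norml => s1.
have pq z c : h z <= c -> 2 * (dotp w (z - y) - s * (c - b)) <=
    a * (dotp (z - y) (z - y) + (c - b) * (c - b)).
  move=> /pair_mx_epi qepi; have := proj_sq pP qepi.
  move=> /(ler_wpM2l a0); rewrite mulrCA -dotpZl YE pE pair_mxB !dotp_pair; lra.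
(* lowering the foot by t yields 2 s <= a t, absurd for small t *)
have bE : b = h y.
  apply/eqP; rewrite eq_le yb andbT leNgt; apply/negP => hb.
  set t := Num.min (b - h y) (s / (a + 1)).
  have t0 : 0 < t by rewrite lt_min subr_gt0 hb divr_gt0 ?ltr_wpDl //; lra.
  have tb : t <= b - h y by rewrite ge_min lexx.
  have ts : t * (a + 1) <= s by rewrite -ler_pdivlMr ?ltr_wpDl // ge_min lexx orbT.
  have := @pq y (b - t); rewrite subrr dotpC !dotp0l => /(_ ltac:(lra)).
  nra.
rewrite {}bE in pq yb pE.
exists y; first lra.
set K := a * (1 + L ^+ 2) / 2.
have K0 : 0 <= K by rewrite divr_ge0 // mulr_ge0 // addr_ge0 // sqr_ge0.
have d0 : 0 < Num.min (r / 2) (e / 4 / (K + 1)).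
  by rewrite lt_min !divr_gt0 ?ltr_wpDl.
apply: filterS (near_enorm y d0) => z.
rewrite lt_min => /andP[zr]; rewrite ltr_pdivlMr ?ltr_wpDl // => zK.
have {}pq := pq z (h z) (lexx _).
have hzy : (h z - h y) * (h z - h y) <= L ^+ 2 * dotp (z - y) (z - y).
  have yxr : enorm (y - x) <= r by lra.
  have zxr : enorm (z - x) <= r by have := ler_enorm_dist y z x; lra.
  have := hLr _ _ zxr yxr.
  rewrite -(@ler_pXn2r _ 2) ?nnegrE ?mulr_ge0 ?enorm_ge0 ?(ltW L0) //.
  by rewrite real_normK ?num_real // exprMn sqr_enorm expr2.
have := dotp_ge (w - s *: v) (z - y).
rewrite dotpBl dotpZl.
have ws : enorm (w - s *: v) <= e / 4.
  have -> : w - s *: v = (w - v) + (1 - s) *: v.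
    by rewrite scalerBl scale1r addrA subrK.
  apply: le_trans (ler_enormD _ _) _; rewrite enormZ.
  have : `|1 - s| * enorm v <= e1 * enorm v.
    by rewrite ler_wpM2r ?enorm_ge0 // ler_norml; lra.
  lra.
rewrite -sqr_enorm in pq hzy.
have DE : h z = h y + (h z - h y) by rewrite addrC subrK.
move: (h z - h y) (dotp w (z - y)) (enorm (z - y)) (enorm_ge0 (z - y))
  => D W n n0 in pq hzy zK zr DE *.
move=> Hw.
have W1 : s * (D - dotp v (z - y) + e * n) >= 0.
  have h1 : enorm (w - s *: v) * n <= e / 4 * n by rewrite ler_wpM2r.
  have h2 : a * (n ^+ 2 + D * D) <= 2 * K * n ^+ 2.
    rewrite /K; have : a * (D * D) <= a * (L ^+ 2 * n ^+ 2) by rewrite ler_wpM2l.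
    lra.
  have h3 : K * n ^+ 2 <= e / 4 * n.
    rewrite expr2 mulrA ler_wpM2r //; lra.
  have h4 : e / 2 * n <= s * (e * n) by rewrite mulrA ler_wpM2r //; nra.
  lra.
have s0 : 0 < s by lra.
by move: W1; rewrite pmulr_rge0 //; lra.
Qed.

End Subgradients.

(** * Calculus of approximate subgradients *)

(** The square root lies below its tangents.  Composed with a quadratic this gives
    exact quadratic upper bounds for Euclidean norms, which stand in for their
    derivatives. *)
Lemma sqrt_le_tangent (R : realType) (a b : R) : 0 < a -> 0 <= b ->
  Num.sqrt b <= Num.sqrt a + (b - a) / (2 * Num.sqrt a).
Proof.
move=> a0 b0; have s0 : 0 < Num.sqrt a by rewrite sqrtr_gt0.
have s20 : 0 < 2 * Num.sqrt a by rewrite mulr_gt0.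
rewrite -lerBlDl ler_pdivlMr //.
have := sqr_sqrtr (ltW a0); have := sqr_sqrtr b0.
have := sqr_ge0 (Num.sqrt a - Num.sqrt b); lra.
Qed.

Lemma ler_addMeps (R : realType) (a b c : R) : 0 <= c ->
  (forall e, 0 < e -> a <= b + c * e) -> a <= b.
Proof.
move=> c0 H; apply/ler_addgt0Pr => e e0.
have /H H' : 0 < e / (c + 1) by rewrite divr_gt0 ?ltr_wpDl.
apply: le_trans H' _; rewrite lerD2l mulrA ler_pdivrMr ?ltr_wpDl //.
by rewrite mulrC ler_wpM2l ?(ltW e0) // lerDl.
Qed.

Section Calculus.
Context {R : realType} {k : nat}.
Implicit Types (h : 'rV[R]_k -> R) (x y v : 'rV[R]_k) (e : R).

(** Changing [v] costs at most |v - v'| |z - y|, by Cauchy-Schwarz. *)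
Lemma approx_subgrad_perturb h v v' e e' y :
  e + enorm (v - v') <= e' -> approx_subgrad h v e y ->
  approx_subgrad h v' e' y.
Proof.
move=> ee; apply: filterS => z H; apply: le_trans H.
have := dotp_ge (v - v') (z - y); rewrite dotpBl.
have : (e + enorm (v - v')) * enorm (z - y) <= e' * enorm (z - y).
  by rewrite ler_wpM2r ?enorm_ge0.
lra.
Qed.

Lemma prox_approx_subgrad h v K e y : 0 < e ->
  (\forall z \near y,
    h y + dotp v (z - y) - K * dotp (z - y) (z - y) <= h z) ->
  approx_subgrad h v e y.
Proof.
move=> e0 H.
have d0 : 0 < e / (`|K| + 1) by rewrite divr_gt0 ?ltr_wpDl.
apply: filterS2 H (near_enorm y d0) => z Hz.
rewrite ltr_pdivlMr ?ltr_wpDl // => zK; apply: le_trans Hz.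
rewrite lerD2l lerN2 -sqr_enorm expr2 mulrA ler_wpM2r ?enorm_ge0 //.
have : K * enorm (z - y) <= `|K| * enorm (z - y).
  by rewrite ler_wpM2r ?enorm_ge0 // ler_norm.
by have := enorm_ge0 (z - y); lra.
Qed.

(** Test the inequality along y + t v for small t > 0. *)
Lemma approx_subgrad_le h v e x y (L r : R) : 0 <= L -> 0 <= e ->
  (forall z z', enorm (z - x) <= r -> enorm (z' - x) <= r ->
    `|h z - h z'| <= L * enorm (z - z')) ->
  enorm (y - x) < r -> approx_subgrad h v e y -> enorm v <= L + e.
Proof.
move=> L0 e0 hL yx /nbhs_enormP[d d0 dP].
have [->|vN0] := eqVneq (enorm v) 0; first by rewrite addr_ge0.
have v0 : 0 < enorm v by rewrite lt_def vN0 enorm_ge0.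
set m := Num.min d (r - enorm (y - x)).
have m0 : 0 < m by rewrite lt_min d0 subr_gt0.
have [md mr] : m <= d /\ m <= r - enorm (y - x).
  by rewrite !ge_min !lexx orbT.
have t0 : 0 < m / 2 / enorm v by rewrite !divr_gt0.
set t := m / 2 / enorm v in t0 *.
have tv : t * enorm v = m / 2 by rewrite /t divfK.
have zy : y + t *: v - y = t *: v by rewrite addrC addKr.
have nz : enorm (y + t *: v - y) = m / 2 by rewrite zy enormZ gtr0_norm.
have /dP : enorm (y + t *: v - y) < d by rewrite nz; lra.
have := hL (y + t *: v) y _ (ltW yx).
have zr : enorm (y + t *: v - x) <= r.
  by have := ler_enorm_dist y (y + t *: v) x; rewrite nz; lra.
move=> /(_ zr); rewrite nz zy dotpZr -sqr_enorm ler_norml => H1 H2.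
have : (t * enorm v) * enorm v <= (t * enorm v) * (L + e).
  rewrite -mulrA -expr2 tv; lra.
by rewrite tv ler_pM2l // divr_gt0.
Qed.

Lemma subdiff_le h x v (L r : R) : locally_lipschitz h -> 0 <= L -> 0 < r ->
  (forall z z', enorm (z - x) <= r -> enorm (z' - x) <= r ->
    `|h z - h z'| <= L * enorm (z - z')) ->
  subdiff h x v -> enorm v <= L.
Proof.
move=> hl L0 r0 hL sv; apply: (@ler_addMeps _ _ _ 1) => // e e0.
have m0 : 0 < Num.min e r by rewrite lt_min e0.
have [y yx ay] := subdiff_approx_subgrad hl sv m0.
have yr : enorm (y - x) < r by apply: lt_le_trans yx _; rewrite ge_min lexx orbT.
apply: le_trans (approx_subgrad_le L0 (ltW m0) hL yr ay) _.
by rewrite mul1r lerD2l ge_min lexx.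
Qed.

(** Approximate subgradients of h' are approximate subgradients of h when h' - h
    is Lipschitz with a small constant near x. *)
Lemma subdiff_stable h x v (r : R) : locally_lipschitz h -> 0 < r ->
  (forall e, 0 < e -> exists h' x' v', [/\ locally_lipschitz h',
      enorm (x' - x) < e, enorm (v' - v) < e, subdiff h' x' v' &
      forall y z, enorm (y - x) <= r -> enorm (z - x) <= r ->
        `|(h' y - h y) - (h' z - h z)| <= e * enorm (y - z)]) ->
  subdiff h x v.
Proof.
move=> hl r0 H; apply: approx_subgrad_subdiff.
  exact: locally_lipschitz_continuous.
move=> e e0; set m := Num.min (e / 4) (r / 4).
have m0 : 0 < m by rewrite lt_min !divr_gt0.
have [me mr] : m <= e / 4 /\ m <= r / 4 by rewrite !ge_min !lexx orbT.
have [h' [x' [v' [h'l xx vv sv hh]]]] := H _ m0.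
have [y yx ay] := subdiff_approx_subgrad h'l sv m0.
have yx0 : enorm (y - x) < 2 * m by have := ler_enorm_dist x' y x; lra.
exists y; first lra.
apply: (@approx_subgrad_perturb _ v' _ (m + m)); first lra.
have r20 : 0 < r / 2 by lra.
apply: filterS2 ay (near_enorm y r20) => z Hz zy.
have := hh z y; rewrite ler_norml.
have -> : enorm (z - x) <= r by have := ler_enorm_dist y z x; lra.
have -> : enorm (y - x) <= r by lra.
by move=> /(_ isT isT); lra.
Qed.

End Calculus.

(** * Sum rule *)

Lemma enorm_sub_continuous {R : realType} {k : nat} :
  continuous (fun p : 'rV[R]_k * 'rV[R]_k => enorm (p.1 - p.2)).
Proof.
move=> [x y]; apply/(@cvgrPdist_lt _ _ _ _ (nbhs_filter (x, y))) => e e0.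
have e20 : 0 < e / 2 by rewrite divr_gt0.
exists ([set z | enorm (z - x) < e / 2], [set z | enorm (z - y) < e / 2]).
  by split; exact: near_enorm.
move=> [z w] [/= zx wy].
have := ler_dist_enorm x z y; have := ler_dist_enorm y w z.
by rewrite !(enormBC _ z) (enormBC y w) !ler_norml ltr_norml; lra.
Qed.

Lemma smoothed_enorm_continuous {R : realType} {k : nat} (x0 : 'rV[R]_k) (d : R) :
  continuous (fun x : 'rV[R]_k => Num.sqrt (enorm (x - x0) ^+ 2 + d)).
Proof.
move=> x; apply: (@continuous_comp _ _ _ (fun x : 'rV[R]_k => enorm (x - x0))
  (fun t => Num.sqrt (t ^+ 2 + d))); first exact: enormB_continuous.
apply: (@continuous_comp _ _ _ (fun t : R => t ^+ 2 + d)).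
  by apply: cvgD; [exact: exprn_continuous | exact: cvg_cst].
exact: sqrt_continuous.
Qed.

Lemma coupled_objective_continuous {R : realType} {k : nat} (f1 f2 phi : 'rV[R]_k -> R)
    (x0 : 'rV[R]_k) (c eps N : R) :
  continuous f1 -> continuous f2 -> continuous phi ->
  continuous (fun p : 'rV[R]_k * 'rV[R]_k =>
    f1 p.1 + c * f2 p.2 + eps * phi p.1 + enorm (p.1 - x0) ^+ 2
    + N * enorm (p.1 - p.2) ^+ 2).
Proof.
move=> f1c f2c pc p; pose V := ('rV[R]_k * 'rV[R]_k)%type.
have fst_c (h : 'rV[R]_k -> R) : continuous h ->
    {for p, continuous (fun p : V => h p.1)}.
  by move=> hc; apply: (@continuous_comp _ _ _ fst h); [exact: cvg_fst|exact: hc].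
have snd_c (h : 'rV[R]_k -> R) : continuous h ->
    {for p, continuous (fun p : V => h p.2)}.
  by move=> hc; apply: (@continuous_comp _ _ _ snd h); [exact: cvg_snd|exact: hc].
have sq_c (h : V -> R) : {for p, continuous h} ->
    {for p, continuous (fun p => h p ^+ 2)}.
  move=> hc; apply: (@continuous_comp _ _ _ h (fun t => t ^+ 2)) => //.
  exact: exprn_continuous.
apply: cvgD; last first.
  apply: cvgM; first exact: cvg_cst.
  exact/sq_c/enorm_sub_continuous.
apply: cvgD; last first.
  apply/sq_c; apply: (fst_c (fun x => enorm (x - x0))); exact: enormB_continuous.
apply: cvgD; last first.
  apply: cvgM; first exact: cvg_cst.
  exact: fst_c.
apply: cvgD; first exact: fst_c.
apply: cvgM; first exact: cvg_cst.
exact: snd_c.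
Qed.

(** The term [eps * enorm (x - x0)] is what a perturbed minimization principle
    leaves behind; it reappears as a bound on the residual [u + c *: v]. *)
Section SumRule.
Context {R : realType} {k : nat}.
Variables (f1 f2 : 'rV[R]_k -> R) (x0 : 'rV[R]_k) (c eps : R).
Hypotheses (f1_lip : locally_lipschitz f1) (f2_lip : locally_lipschitz f2).
Hypotheses (c0 : 0 < c) (eps0 : 0 <= eps).
Hypothesis x0_min : \forall x \near x0,
  f1 x0 + c * f2 x0 <= f1 x + c * f2 x + eps * enorm (x - x0).

(** Decoupling: minimize f1(x) + c f2(y) + eps phi(x) + |x - x0|^2 + N |x - y|^2 over
    pairs, where phi is a smooth majorant of |x - x0|.  For N large the minimizing
    pair (a, b) is close to (x0, x0); minimality in x alone, resp. y alone, gives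
    proximal subgradients in which the terms 2 N (a - b) cancel. *)
Lemma fuzzy_sum_rule eta : 0 < eta -> exists y1 y2 u v,
  [/\ enorm (y1 - x0) < eta, enorm (y2 - x0) < eta,
      approx_subgrad f1 u eta y1, approx_subgrad f2 v eta y2
    & enorm (u + c *: v) <= eps + eta].
Proof.
move=> eta0.
have [L [r1 [L0 r10 f2L]]] := locally_lipschitz_enorm f2_lip x0.
have /nbhs_enormP[r2 r20 r2P] := x0_min.
(* [rho] bounds the distances of a and b to x0; the values of [kap], [del] and [N]
   below are chosen to achieve this *)
have [rho [rho0 rho_eta rho_r1 rho_r2]] : exists rho,
    [/\ 0 < rho, rho <= eta / 4, rho <= r1 / 2 & rho <= r2 / 4].
  exists (Num.min (eta / 4) (Num.min (r1 / 2) (r2 / 4))); split.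
  - by rewrite !lt_min !divr_gt0.
  - by rewrite !ge_min lexx.
  - by rewrite !ge_min lexx !orbT.
  - by rewrite !ge_min lexx !orbT.
set kap := rho ^+ 2 / 8; have kap0 : 0 < kap by rewrite divr_gt0 ?exprn_gt0.
have e10 : 0 < eps + 1 by rewrite ltr_wpDl.
set del := kap / (eps + 1); have del0 : 0 < del by rewrite divr_gt0.
have epsdel : eps * del <= kap.
  by rewrite /del mulrA ler_pdivrMr // mulrC ler_pM2l // lerDl.
set N := (c * L) ^+ 2 / kap + 1.
have cL0 : 0 < c * L by rewrite mulr_gt0.
have N1 : 1 <= N by rewrite lerDr divr_ge0 ?sqr_ge0 // ltW.
have NcL : (c * L) ^+ 2 <= N * kap by rewrite -ler_pdivrMr // lerDl.
pose phi x := Num.sqrt (enorm (x - x0) ^+ 2 + del ^+ 2).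
have phiE x : enorm (x - x0) <= phi x.
  rewrite -[leLHS]ger0_norm ?enorm_ge0 // -sqrtr_sqr ler_wsqrtr //.
  by rewrite lerDl sqr_ge0.
have phi0 : phi x0 = del.
  by rewrite /phi subrr enorm0 expr0n add0r sqrtr_sqr gtr0_norm.
pose Psi (p : 'rV[R]_k * 'rV[R]_k) : R := f1 p.1 + c * f2 p.2 + eps * phi p.1
  + enorm (p.1 - x0) ^+ 2 + N * enorm (p.1 - p.2) ^+ 2.
pose B := [set y : 'rV[R]_k | enorm (y - x0) <= 2 * rho].
have [[a b] [Ba Bb] abmin] : exists2 p, (B `*` B) p &
    forall q, (B `*` B) q -> Psi p <= Psi q.
  have Bx0 : (B `*` B) (x0, x0).
    by split; rewrite /B /= subrr enorm0 mulr_ge0 // ltW.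
  have Bc : compact (B `*` B) by apply: compact_setX; exact: enorm_ball_compact.
  have PsiC : {within B `*` B, continuous Psi}.
    apply: continuous_subspaceT; apply: coupled_objective_continuous.
    - exact: locally_lipschitz_continuous.
    - exact: locally_lipschitz_continuous.
    - exact: smoothed_enorm_continuous.
  have [|p /set_mem Bp pmin] := compact_EVT_min _ Bc PsiC; first by exists (x0, x0).
  by exists p => // q Bq; apply: pmin; exact/mem_set.
have s0 := enorm_ge0 (a - x0); have t0 := enorm_ge0 (a - b).
rewrite /B /= in Ba Bb.
(* compare with (x0, x0), using minimality of x0 at the point a *)
have key : enorm (a - x0) ^+ 2 + N * enorm (a - b) ^+ 2 <=
    kap + c * L * enorm (a - b).
  have : Psi (a, b) <= Psi (x0, x0).
    by apply: abmin; split; rewrite /B /= subrr enorm0 mulr_ge0 // ltW.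
  rewrite /Psi /= !subrr enorm0 phi0.
  have aB : enorm (a - x0) < r2 by lra.
  have := r2P _ aB.
  have : c * (f2 a - f2 b) <= c * (L * enorm (a - b)).
    rewrite ler_pM2l //; apply: le_trans (ler_norm _) _; apply: f2L; lra.
  have : eps * enorm (a - x0) <= eps * phi a by rewrite ler_wpM2l.
  rewrite [0 ^+ 2]expr2 mul0r mulr0; lra.
have NcLt : 2 * (c * L * enorm (a - b)) <= N * enorm (a - b) ^+ 2 + kap.
  have Np : 0 < N by lra.
  rewrite -(ler_pM2l Np); have := sqr_ge0 (N * enorm (a - b) - c * L).
  move: NcL; lra.
have sN : enorm (a - x0) < rho.
  rewrite -(@ltr_pXn2r _ 2) ?nnegrE ?(ltW rho0) //.
  have := sqr_ge0 (enorm (a - b)); rewrite /kap in key NcLt kap0; nra.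
have tN : enorm (a - b) < rho.
  rewrite -(@ltr_pXn2r _ 2) ?nnegrE ?(ltW rho0) //.
  have := sqr_ge0 (enorm (a - b)); have := sqr_ge0 (enorm (a - x0)).
  rewrite /kap in key NcLt kap0; nra.
have bN : enorm (b - x0) < 2 * rho.
  by have := ler_enorm_dist a b x0; rewrite (enormBC b a); lra.
have pa0 : 0 < phi a by rewrite sqrtr_gt0 ltr_wpDl ?sqr_ge0 // exprn_gt0.
pose u := - ((eps / phi a + 2) *: (a - x0)) - (2 * N) *: (a - b).
pose v := (2 * N / c) *: (a - b).
exists a, b, u, v; split; [lra | lra | | |].
- apply: (@prox_approx_subgrad _ _ _ _ (eps / (2 * phi a) + 1 + N)) => //.
  apply: filterS (near_enorm a rho0) => z za.
  have zB : enorm (z - x0) <= 2 * rho by have := ler_enorm_dist a z x0; lra.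
  have := abmin (z, b) (conj zB Bb); rewrite /Psi /=.
  have : eps * phi z <= eps * (phi a +
      (enorm (z - x0) ^+ 2 - enorm (a - x0) ^+ 2) / (2 * phi a)).
    have b0 : 0 <= enorm (z - x0) ^+ 2 + del ^+ 2 by rewrite addr_ge0 ?sqr_ge0.
    rewrite sqrtr_gt0 in pa0; rewrite ler_wpM2l //.
    apply: le_trans (sqrt_le_tangent pa0 b0) _.
    by rewrite opprD addrACA subrr addr0.
  rewrite !sqr_enorm /u.
  have -> : z - x0 = (a - x0) + (z - a) by rewrite [RHS]addrC subrKA.
  have -> : z - b = (a - b) + (z - a) by rewrite [RHS]addrC subrKA.
  move: (z - a) (a - x0) (a - b) => d p q.
  rewrite !(dotpDl, dotpDr, dotpNl, dotpZl) (dotpC d p) (dotpC d q).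
  have -> : (dotp p p + dotp p d + (dotp p d + dotp d d) - dotp p p) / (2 * phi a) =
    dotp p d / phi a + dotp d d / (2 * phi a) by field; rewrite gt_eqF.
  lra.
- apply: (@prox_approx_subgrad _ _ _ _ (N / c)) => //.
  have d0 : 0 < 2 * rho - enorm (b - x0) by lra.
  apply: filterS (near_enorm b d0) => z za.
  have zB : enorm (z - x0) <= 2 * rho by have := ler_enorm_dist b z x0; lra.
  have := abmin (a, z) (conj Ba zB); rewrite /Psi /=.
  rewrite !sqr_enorm /v.
  have -> : a - z = (a - b) - (z - b) by rewrite opprB addrA subrK.
  move: (z - b) (a - b) => d q.
  rewrite !(dotpBl, dotpBr, dotpZl) (dotpC d q) => H.
  rewrite -(ler_pM2l c0).
  have -> : c * (f2 b + 2 * N / c * dotp q d - N / c * dotp d d) =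
    c * f2 b + 2 * N * dotp q d - N * dotp d d by field; rewrite gt_eqF.
  lra.
- have -> : u + c *: v = - ((eps / phi a + 2) *: (a - x0)).
    by rewrite /u /v scalerA (mulrC c) divfK ?gt_eqF // subrK.
  rewrite enormN enormZ ger0_norm ?addr_ge0 ?divr_ge0 ?(ltW pa0) // mulrDl.
  apply: lerD; last by lra.
  by rewrite -mulrA ler_piMr // mulrC ler_pdivrMr // mul1r.
Qed.

End SumRule.

(** The three dimensions are independent because points, multipliers and
    subgradients are extracted together; 1/(i+1) < e encodes a late index. *)
Lemma bounded_cluster (R : realType) (k1 k2 k3 : nat) (M1 M2 M3 : R)
    (u1 : nat -> 'rV[R]_k1) (u2 : nat -> 'rV[R]_k2) (u3 : nat -> 'rV[R]_k3) :
  (forall i, enorm (u1 i) <= M1) -> (forall i, enorm (u2 i) <= M2) ->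
  (forall i, enorm (u3 i) <= M3) ->
  exists l1 l2 l3, forall e, 0 < e ->
    exists i, [/\ i.+1%:R^-1 < e, enorm (u1 i - l1) < e,
                  enorm (u2 i - l2) < e & enorm (u3 i - l3) < e].
Proof.
move=> uM1 uM2 uM3.
have bc k M := @enorm_ball_compact R k 0 M.
have Kc := compact_setX (compact_setX (bc k1 M1) (bc k2 M2)) (bc k3 M3).
have [|[[l1 l2] l3] lP] :=
  @compact_seq_cluster _ _ (fun i => (u1 i, u2 i, u3 i)) Kc.
  by move=> i; split; [split|]; rewrite /= subr0.
exists l1, l2, l3 => e e0.
have [N _ NP] := near_invS_lt e0.
pose U := [set p : 'rV[R]_k1 * 'rV[R]_k2 * 'rV[R]_k3 |
  [/\ enorm (p.1.1 - l1) < e, enorm (p.1.2 - l2) < e & enorm (p.2 - l3) < e]].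
have lU : nbhs (l1, l2, l3) U.
  exists ([set p : 'rV[R]_k1 * 'rV[R]_k2 |
     enorm (p.1 - l1) < e /\ enorm (p.2 - l2) < e],
     [set z | enorm (z - l3) < e]); last by move=> [[p q] z] [/= [? ?] ?].
  split => /=; last exact: near_enorm.
  exists ([set z | enorm (z - l1) < e], [set z | enorm (z - l2) < e]) => //.
  by split; exact: near_enorm.
by have [i Ni [/= ? ? ?]] := lP _ lU N; exists i; split => //; exact: NP.
Qed.

(** Compactness applied to the fuzzy rule: the Lipschitz constants bound the
    approximate subgradients, and by stability their cluster points are genuine
    limiting subgradients at x0. *)
Lemma limiting_sum_rule {R : realType} {k : nat} (f1 f2 : 'rV[R]_k -> R)
    (x0 : 'rV[R]_k) (c eps : R) :
  locally_lipschitz f1 -> locally_lipschitz f2 -> 0 < c -> 0 <= eps ->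
  (\forall x \near x0,
    f1 x0 + c * f2 x0 <= f1 x + c * f2 x + eps * enorm (x - x0)) ->
  exists u v, [/\ subdiff f1 x0 u, subdiff f2 x0 v
                & enorm (u + c *: v) <= eps].
Proof.
move=> l1 l2 c0 eps0 x0_min.
have [L1 [r1 [L10 r10 f1L]]] := locally_lipschitz_enorm l1 x0.
have [L2 [r2 [L20 r20 f2L]]] := locally_lipschitz_enorm l2 x0.
pose eta (i : nat) := Num.min i.+1%:R^-1 (Num.min 1 (Num.min r1 r2)) : R.
have etaP i : [/\ 0 < eta i, eta i <= i.+1%:R^-1, eta i <= 1, eta i <= r1
    & eta i <= r2].
  by rewrite !lt_min !ge_min !lexx !orbT invr_gt0 ltr0n ltr01 r10 r20.
have /choice[s sP] : forall i, exists p : 'rV[R]_k * 'rV[R]_k,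
    exists y1 y2, [/\ enorm (y1 - x0) < eta i, enorm (y2 - x0) < eta i,
      approx_subgrad f1 p.1 (eta i) y1, approx_subgrad f2 p.2 (eta i) y2
    & enorm (p.1 + c *: p.2) <= eps + eta i].
  move=> i; have [ei _ _ _ _] := etaP i.
  have [y1 [y2 [u [v P]]]] := fuzzy_sum_rule l1 l2 c0 eps0 x0_min ei.
  by exists (u, v), y1, y2.
have b1 i : enorm (s i).1 <= L1 + 1.
  have [e0 _ e1 er1 _] := etaP i; have [y1 [_ [yx _ a1 _ _]]] := sP i.
  apply: le_trans (_ : L1 + eta i <= _); last by rewrite lerD2l.
  exact: approx_subgrad_le (ltW L10) (ltW e0) f1L (lt_le_trans yx er1) a1.
have b2 i : enorm (s i).2 <= L2 + 1.
  have [e0 _ e1 _ er2] := etaP i; have [_ [y2 [_ yx _ a2 _]]] := sP i.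
  apply: le_trans (_ : L2 + eta i <= _); last by rewrite lerD2l.
  exact: approx_subgrad_le (ltW L20) (ltW e0) f2L (lt_le_trans yx er2) a2.
have [u [v [w uvP]]] := bounded_cluster b1 b2 b2.
exists u, v; split.
- apply: approx_subgrad_subdiff; first exact: locally_lipschitz_continuous.
  move=> e e0; have e20 : 0 < e / 2 by rewrite divr_gt0.
  have [i [ie ui _ _]] := uvP _ e20; have [_ /le_lt_trans/(_ ie) ei _ _ _] := etaP i.
  have [y1 [_ [yx _ a1 _ _]]] := sP i; exists y1; first lra.
  by apply: approx_subgrad_perturb a1; lra.
- apply: approx_subgrad_subdiff; first exact: locally_lipschitz_continuous.
  move=> e e0; have e20 : 0 < e / 2 by rewrite divr_gt0.
  have [i [ie _ vi _]] := uvP _ e20; have [_ /le_lt_trans/(_ ie) ei _ _ _] := etaP i.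
  have [_ [y2 [_ yx _ a2 _]]] := sP i; exists y2; first lra.
  by apply: approx_subgrad_perturb a2; lra.
apply: (@ler_addMeps _ _ _ (2 + c)) => [|e e0]; first by rewrite addr_ge0 ?(ltW c0).
have [i [ie ui vi _]] := uvP _ e0; have [_ /le_lt_trans/(_ ie) ei _ _ _] := etaP i.
have [_ [_ [_ _ _ _ uv]]] := sP i.
have -> : u + c *: v = ((s i).1 + c *: (s i).2) - (((s i).1 - u) + c *: ((s i).2 - v)).
  by rewrite scalerBr addrACA -opprD subKr.
apply: le_trans (ler_enormB _ _) _.
have := ler_enormD ((s i).1 - u) (c *: ((s i).2 - v)).
rewrite enormZ gtr0_norm //.
have : c * enorm ((s i).2 - v) <= c * e by rewrite ler_pM2l // ltW.
lra.
Qed.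

(** * Scalarizations of a locally Lipschitz mapping *)

Lemma enorm_locally_lipschitz (R : realType) (k : nat) (h : 'rV[R]_k -> R) :
  (forall x, exists L r, [/\ 0 < L, 0 < r &
    forall y z, enorm (y - x) <= r -> enorm (z - x) <= r ->
      `|h y - h z| <= L * enorm (y - z)]) ->
  locally_lipschitz h.
Proof.
move=> H x; have [L [r [L0 r0 hL]]] := H x.
exists [set y | enorm (y - x) <= r].
  by apply: filterS (near_enorm x r0) => y /ltW.
exists (L * k%:R); split; first exact: num_real.
move=> M LM [y z] [/= yx zx]; apply: le_trans (hL _ _ yx zx) _.
apply: le_trans (_ : L * (k%:R * `|y - z|) <= _).
  by rewrite ler_pM2l // enorm_le_norm.
by rewrite mulrA ler_wpM2r // ltW.
Qed.

Section Scalarization.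
Context {R : realType} {n m : nat}.
Variables (g : 'rV[R]_n -> 'rV[R]_m).
Hypothesis g_lip : locally_lipschitz g.

Lemma scalarization_lipschitz w : locally_lipschitz (scalarization g w).
Proof.
apply: enorm_locally_lipschitz => x.
have [L [r [L0 r0 gL]]] := locally_lipschitz_enorm_vec g_lip x.
exists ((enorm w + 1) * L), r; split => //.
  by rewrite mulr_gt0 // ltr_wpDl ?enorm_ge0.
move=> y z yx zx; rewrite /scalarization -dotpBr.
have : enorm w * enorm (g y - g z) <= (enorm w + 1) * (L * enorm (y - z)).
  by apply: ler_pM; rewrite ?enorm_ge0 ?lerDl ?gL.
have := dotp_le w (g y - g z); have := dotp_ge w (g y - g z).
by rewrite ler_norml; lra.
Qed.

(** <w', g> - <w, g> = <w' - w, g> is Lipschitz with a constant proportional to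
    |w' - w|, so the subdifferential is closed jointly in the point, the
    multiplier and the subgradient. *)
Lemma scalarization_subdiff_stable x w v :
  (forall e, 0 < e -> exists x' w' v', [/\ enorm (x' - x) < e,
     enorm (w' - w) < e, enorm (v' - v) < e
   & subdiff (scalarization g w') x' v']) ->
  subdiff (scalarization g w) x v.
Proof.
have [L [r [L0 r0 gL]]] := locally_lipschitz_enorm_vec g_lip x.
move=> H; apply: (subdiff_stable (scalarization_lipschitz w) r0) => e e0.
have m0 : 0 < Num.min e (e / L) by rewrite lt_min e0 divr_gt0.
have [x' [w' [v' []]]] := H _ m0.
rewrite !lt_min => /andP[xx _] /andP[we ww] /andP[vv _] sv.
rewrite ltr_pdivlMr // in ww; exists (scalarization g w'), x', v'; split=> //.
  exact: scalarization_lipschitz.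
move=> y z yx zx; rewrite /scalarization -!dotpBl -dotpBr.
have : enorm (w' - w) * enorm (g y - g z) <=
       enorm (w' - w) * (L * enorm (y - z)).
  by rewrite ler_wpM2l ?enorm_ge0 // gL.
have : enorm (w' - w) * L * enorm (y - z) <= e * enorm (y - z).
  by rewrite ler_wpM2r ?enorm_ge0 // ltW.
have := dotp_le (w' - w) (g y - g z); have := dotp_ge (w' - w) (g y - g z).
by rewrite ler_norml; lra.
Qed.

End Scalarization.

Lemma subdiff_closed {R : realType} {k : nat} (h : 'rV[R]_k -> R) x v :
  locally_lipschitz h ->
  (forall e, 0 < e -> exists x' v', [/\ enorm (x' - x) < e,
     enorm (v' - v) < e & subdiff h x' v']) ->
  subdiff h x v.
Proof.
move=> hl H; apply: (subdiff_stable hl ltr01) => e e0.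
have [x' [v' [xx vv sv]]] := H _ e0; exists h, x', v'; split => // y z _ _.
by rewrite !subrr normr0 mulr_ge0 ?enorm_ge0 // ltW.
Qed.

(** * Stationarity for the penalized problem *)

Section Stationarity.
Context {R : realType} {n m : nat}.
Variables (f : 'rV[R]_n -> R) (g : 'rV[R]_n -> 'rV[R]_m) (C : set 'rV[R]_m).
Hypotheses (f_lip : locally_lipschitz f) (g_lip : locally_lipschitz g).
Hypotheses (C_neq0 : C !=set0).

(** Replacing dist C (g z) by |g z - p| only increases the objective away from x,
    and the square root then lies below its tangent at x.  The remainder
    |g z - g x|^2 is O(|z - x|^2), hence absorbed in a second eps |z - x|.  The sum
    rule applies to f + c <w, g>.  With del = 0 the statement concerns the penalty
    itself at an infeasible point. *)
Lemma smoothed_penalty_stationary (c eps del : R) x p :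
  0 < c -> 0 < eps -> Defs.proj C (g x) p ->
  let s := Num.sqrt (dist C (g x) ^+ 2 + del ^+ 2) in 0 < s ->
  (\forall z \near x, f x + c * s <=
     f z + c * Num.sqrt (dist C (g z) ^+ 2 + del ^+ 2) + eps * enorm (z - x)) ->
  exists u v, [/\ subdiff f x u,
    subdiff (scalarization g (s^-1 *: (g x - p))) x v
  & enorm (u + c *: v) <= 2 * eps].
Proof.
move=> c0 eps0 [Cp xp] s s0 xmin.
have e20 : 0 <= 2 * eps by rewrite mulr_ge0 // ltW.
apply: (limiting_sum_rule f_lip (scalarization_lipschitz g_lip _) c0 e20).
have [L [r [L0 r0 gL]]] := locally_lipschitz_enorm_vec g_lip x.
set K := c * (L ^+ 2 / (2 * s)).
have K0 : 0 < K by rewrite mulr_gt0 // divr_gt0 ?exprn_gt0 ?mulr_gt0.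
have d0 : 0 < Num.min r (eps / K) by rewrite lt_min r0 divr_gt0.
apply: filterS2 xmin (near_enorm x d0) => z zmin.
rewrite lt_min ltr_pdivlMr // => /andP[zr zK].
have gz : enorm (g z - g x) <= L * enorm (z - x).
  by apply: gL; [exact: ltW | rewrite subrr enorm0 ltW].
have gz2 : dotp (g z - g x) (g z - g x) <= L ^+ 2 * enorm (z - x) ^+ 2.
  by rewrite -sqr_enorm -exprMn ler_pXn2r ?nnegrE ?mulr_ge0 ?enorm_ge0 ?(ltW L0).
have a0 : 0 < enorm (g x - p) ^+ 2 + del ^+ 2 by rewrite xp -sqrtr_gt0.
have b0 : 0 <= enorm (g z - p) ^+ 2 + del ^+ 2 by rewrite addr_ge0 ?sqr_ge0.
have := sqrt_le_tangent a0 b0.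
rewrite {1}xp {2}xp -/s opprD addrACA subrr addr0 => tg.
have dz : Num.sqrt (dist C (g z) ^+ 2 + del ^+ 2) <=
    Num.sqrt (enorm (g z - p) ^+ 2 + del ^+ 2).
  rewrite ler_wsqrtr // lerD2r ler_pXn2r ?nnegrE ?enorm_ge0 ?dist_ge0 //.
  exact: dist_le.
have {dz}tg := le_trans dz tg.
move: tg zmin; rewrite !sqr_enorm /scalarization.
have -> : g z - p = (g x - p) + (g z - g x) by rewrite [RHS]addrC subrKA.
have -> : dotp (s^-1 *: (g x - p)) (g z) = dotp (s^-1 *: (g x - p)) (g x)
    + s^-1 * dotp (g x - p) (g z - g x).
  by rewrite -dotpZl -dotpDr [g x + (_ - _)]addrC subrK.
move: (g z - g x) (g x - p) gz2 => D q gz2.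
rewrite !(dotpDl, dotpDr) (dotpC D q) => /(ler_wpM2l (ltW c0)).
have -> : (dotp q q + dotp q D + (dotp q D + dotp D D) - dotp q q) / (2 * s)
  = s^-1 * dotp q D + dotp D D / (2 * s) by field; rewrite gt_eqF.
have : c * (dotp D D / (2 * s)) <= eps * enorm (z - x).
  apply: le_trans (_ : K * enorm (z - x) ^+ 2 <= _).
    rewrite /K -mulrA ler_pM2l // mulrAC ler_pM2r // invr_gt0 mulr_gt0 //.
  by rewrite expr2 mulrA ler_wpM2r ?enorm_ge0 // mulrC ltW.
lra.
Qed.

End Stationarity.

(** * Infeasible critical points of the penalty *)

Lemma continuous_addZ {T : topologicalType} {R : realType} (h1 h2 : T -> R) (c : R) :
  continuous h1 -> continuous h2 -> continuous (fun z => h1 z + c * h2 z).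
Proof.
move=> h1c h2c x; apply: cvgD; first exact: h1c.
by apply: cvgM; [exact: cvg_cst | exact: h2c].
Qed.

Section ExactPenalty.
Context {R : realType} {n m : nat}.
Variables (f : 'rV[R]_n -> R) (g : 'rV[R]_n -> 'rV[R]_m) (C : set 'rV[R]_m).
Hypotheses (f_lip : locally_lipschitz f) (g_lip : locally_lipschitz g).
Hypotheses (C_neq0 : C !=set0) (C_closed : closed C).

Local Notation feas := (feasible g C).
Local Notation pen := (penalty f g C).

(** The output of the perturbed minimization at a parameter c >= i + 1.  The
    scaling of [eps] by [enorm x] is what controls |x| nu(x), and [eps <= M] what
    makes the residual negligible against [c]. *)
Definition penalty_critical (M : R) (i : nat) (x : 'rV[R]_n) : Prop :=
  exists c eps p u v, [/\ i.+1%:R <= c, 0 <= eps <= M /\ eps * enorm x <= 2 * M,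
    Defs.proj C (g x) p,
    subdiff f x u /\
      subdiff (scalarization g ((dist C (g x))^-1 *: (g x - p))) x v
  & enorm (u + c *: v) <= 2 * eps].

Lemma penalty_feasible c x : feas x -> pen c x = f x.
Proof. by move=> Sx; rewrite /penalty dist_mem // mulr0 addr0. Qed.

Lemma dist_gt0 x : ~ feas x -> 0 < dist C (g x).
Proof.
move=> Sx; rewrite lt_def dist_ge0 // andbT; apply/eqP => d0; apply: Sx.
exact: dist_eq0 C_closed C_neq0 d0.
Qed.

Lemma distg_continuous : continuous (fun x => dist C (g x)).
Proof.
apply: locally_lipschitz_continuous; apply: enorm_locally_lipschitz => x.
have [L [r [L0 r0 gL]]] := locally_lipschitz_enorm_vec g_lip x.
exists L, r; split => // y z yx zx.
exact: le_trans (dist_lip _ _ C_closed C_neq0) (gL _ _ yx zx).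
Qed.

(** Finite-dimensional Ekeland principle, with slope M / (1 + |a|) adapted to the
    starting point.  Outside the ball of radius 1 + |a| about a the slope term
    alone exceeds M, so the lower bound B gives at least B + M = fs > F_c(a) there:
    a minimizer over the ball is global. *)
Lemma penalty_critical_exists (fs B c : R) (i : nat) a :
  (forall z, feas z -> fs <= f z) -> (forall z, B <= pen c z) -> i.+1%:R <= c ->
  pen c a < fs ->
  exists x, [/\ ~ feas x, pen c x < fs & penalty_critical (fs - B) i x].
Proof.
move=> fsP BP ic Pa.
have c0 : 0 < c by apply: lt_le_trans ic; rewrite ltr0n.
set M := fs - B; have M0 : 0 < M by have := BP a; rewrite /M; lra.
have a0 : 0 < 1 + enorm a by rewrite ltr_wpDr ?enorm_ge0.
set eps := M / (1 + enorm a); have eps0 : 0 < eps by rewrite divr_gt0.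
have epsM : eps * (1 + enorm a) = M by rewrite divfK ?gt_eqF.
pose K := [set y | enorm (y - a) <= 1 + enorm a].
have Pc : continuous (pen c).
  apply: continuous_addZ; last exact: distg_continuous.
  exact: locally_lipschitz_continuous.
have hc : continuous (fun z : 'rV[R]_n => pen c z + eps * enorm (z - a)).
  by apply: continuous_addZ => //; exact: enormB_continuous.
have Kc : compact K by exact: enorm_ball_compact.
have Ka : K a by rewrite /K /= subrr enorm0 ltW.
have [||x /set_mem Kx xK] :=
  @EVT_min_rV _ _ (fun z : 'rV[R]_n => pen c z + eps * enorm (z - a)) K _ Kc.
- by exists a.
- exact: continuous_subspaceT.
have xa : pen c x + eps * enorm (x - a) <= pen c a.
  by have := xK _ (mem_set Ka); rewrite subrr enorm0 mulr0 addr0.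
have xmin z : pen c x + eps * enorm (x - a) <= pen c z + eps * enorm (z - a).
  have [zK|zK] := leP (enorm (z - a)) (1 + enorm a).
    by apply: xK; exact/mem_set.
  apply: le_trans xa _; have := BP z.
  have : eps * (1 + enorm a) <= eps * enorm (z - a) by rewrite ler_pM2l // ltW.
  rewrite epsM /M; lra.
have xfs : pen c x < fs.
  by have := mulr_ge0 (ltW eps0) (enorm_ge0 (x - a)); lra.
have nSx : ~ feas x by move=> Sx; move: xfs; rewrite penalty_feasible // ltNge fsP.
exists x; split=> //.
have [p pP] := proj_neq0 (g x) C_closed C_neq0.
have d0 := dist_gt0 nSx.
have sE z : Num.sqrt (dist C (g z) ^+ 2 + 0 ^+ 2) = dist C (g z).
  by rewrite [0 ^+ 2]expr2 mul0r addr0 sqrtr_sqr ger0_norm // dist_ge0.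
have [||u [v [fu gv uv]]] := @smoothed_penalty_stationary _ _ _ f g C f_lip g_lip C_neq0
    c eps 0 x p c0 eps0 pP.
- by rewrite sE.
- apply/nbhs_enormP; exists 1 => // z _; rewrite !sE; have := xmin z; rewrite /penalty.
  have : eps * enorm (z - a) <= eps * (enorm (z - x) + enorm (x - a)).
    by rewrite ler_pM2l // ler_enorm_dist.
  lra.
exists c, eps, p, u, v; split => //; last by rewrite sE in gv.
have epsle : eps <= M.
  by rewrite -epsM ler_peMr ?(ltW eps0) // lerDl enorm_ge0.
rewrite (ltW eps0) epsle; split=> //.
rewrite -epsM mulrCA ler_pM2l //.
have := ler_enorm_sub x a; rewrite /K /= in Kx; lra.
Qed.

(** The residual u + c v, divided by 1 + c, is a convex combination of u and v with
    weight 1/(1 + c), so nu x <= 2 eps / (1 + c).  That nu x is a real number is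
    needed to compute the product with the norm in the extended reals. *)
Lemma nu_penalty_critical M i x : penalty_critical M i x ->
  exists2 r, nu f g C x = r%:E & 0 <= enorm x * r <= 4 * M * i.+1%:R^-1.
Proof.
move=> [c [eps [p [u [v [ic [/andP[eps0 epsM] epsx] pP [fu gv] uv]]]]]].
have i0 : 0 < i.+1%:R :> R by rewrite ltr0n.
have c0 : 0 < c := lt_le_trans i0 ic.
have c10 : 0 < 1 + c by rewrite addr_gt0.
have nu0 : (0 <= nu f g C x)%E.
  apply: le_ereal_inf_tmp => _ [lam [u' [v' [w' [_ _ _ _ ->]]]]].
  by rewrite lee_fin enorm_ge0.
have nule : (nu f g C x <= (2 * eps / (1 + c))%:E)%E.
  apply: ge_ereal_inf; exists (enorm ((1 + c)^-1 *: u + (1 - (1 + c)^-1) *: v))%:E.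
    exists (1 + c)^-1, u, v, ((dist C (g x))^-1 *: (g x - p)); split => //.
    + by rewrite invr_gt0 c10 invf_lt1 // ltrDl.
    + by exists p.
  have -> : (1 + c)^-1 *: u + (1 - (1 + c)^-1) *: v = (1 + c)^-1 *: (u + c *: v).
    rewrite scalerDr scalerA; congr (_ + _ *: _); field; rewrite gt_eqF //.
  by rewrite lee_fin enormZ gtr0_norm ?invr_gt0 // mulrC ler_pM2r ?invr_gt0.
have nufin : nu f g C x \is a fin_num.
  by apply/fin_real/andP; split; [apply: lt_le_trans nu0 | apply: le_lt_trans nule _];
    rewrite ?ltNyr ?ltry.
exists (fine (nu f g C x)); first by rewrite fineK.
move: nu0 nule; rewrite -(fineK nufin) !lee_fin => r0 rle.
rewrite mulr_ge0 ?enorm_ge0 //=.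
apply: le_trans (_ : enorm x * (2 * eps / (1 + c)) <= _).
  by rewrite ler_wpM2l ?enorm_ge0.
have -> : enorm x * (2 * eps / (1 + c)) = 2 * (eps * enorm x) / (1 + c).
  by field; rewrite gt_eqF.
apply: (@le_trans _ _ (4 * M / (1 + c))).
  by rewrite ler_pM2r ?invr_gt0 //; lra.
rewrite ler_wpM2l //; last by rewrite lef_pV2 ?posrE //; lra.
by have := mulr_ge0 eps0 (enorm_ge0 x); lra.
Qed.

(** Only the values f (x_ i) need a subsequence; the other limits hold along the
    whole sequence, those of |x| nu(x) and of the distance at rate 1/i. *)
Lemma unbounded_critical_K_infty (M b1 b2 : R) (x_ : nat -> 'rV[R]_n) :
  (forall i, ~ feas (x_ i)) -> (forall i, penalty_critical M i (x_ i)) ->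
  (forall i, i.+1%:R * dist C (g (x_ i)) <= M) ->
  (forall i, b1 <= f (x_ i) <= b2) ->
  (forall K, exists N, forall i, (N <= i)%N -> K <= enorm (x_ i)) ->
  exists2 t, K_infty f g C t & t <= b2.
Proof.
move=> nS crit dM fb unb.
have sc : compact (`[b1, b2]%classic : set R) by exact: segment_compact.
have [|t tP] := @compact_seq_cluster R _ (fun i => f (x_ i)) sc.
  by move=> i; rewrite /= in_itv /= fb.
have near_t (e : R) N : 0 < e -> exists2 i, (N <= i)%N & `|t - f (x_ i)| < e.
  by move=> e0; apply: (tP (fun y => `|t - y| < e)); exact: nbhsx_ballx.
have /choice[phi phiP] : forall k : nat, exists i,
    (k <= i)%N /\ `|t - f (x_ i)| < k.+1%:R^-1.
  move=> k; have [|i ki ti] := near_t k.+1%:R^-1 k; first by rewrite invr_gt0.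
  by exists i.
have M0 : 0 <= M by apply: le_trans (dM 0%N); rewrite mul1r dist_ge0.
have invle k : (phi k).+1%:R^-1 <= k.+1%:R^-1 :> R.
  by rewrite lef_pV2 ?posrE ?ltr0n // ler_nat ltnS; case: (phiP k).
have small (u : nat -> R) D : 0 <= D -> (forall k, 0 <= u k <= D * (phi k).+1%:R^-1) ->
    u k @[k --> \oo] --> 0.
  move=> D0 uD; apply/cvgrPdist_lt => e e0.
  have d0 : 0 < e / (D + 1) by rewrite divr_gt0 ?ltr_wpDl.
  apply: filterS (near_invS_lt d0) => k /(le_lt_trans (invle k)).
  rewrite ltr_pdivlMr ?ltr_wpDl // => ke.
  have /andP[u0 uk] := uD k; rewrite sub0r normrN ger0_norm //.
  apply: le_lt_trans uk _; apply: le_lt_trans ke.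
  by rewrite mulrC ler_wpM2l ?invr_ge0 ?ler0n // lerDl.
exists t; last first.
  apply/ler_addgt0Pr => e e0; have [i _] := near_t e 0%N e0.
  by have /andP[_] := fb i; rewrite ltr_norml; lra.
exists (x_ \o phi); split => /=.
- by move=> k; exact: nS.
- apply/cvgryPge => A; have [N NP] := unb A; exists N => // k /= Nk.
  by apply: NP; apply: leq_trans Nk _; case: (phiP k).
- have /choice[r rP] : forall k, exists r : R, nu f g C (x_ (phi k)) = r%:E /\
      0 <= enorm (x_ (phi k)) * r <= 4 * M * (phi k).+1%:R^-1.
    move=> k; have [r ? ?] := nu_penalty_critical (crit (phi k)).
    by exists r.
  apply/fine_cvgP; split.
    by apply: nearW => k; have [-> _] := rP k.
  apply: (@small _ (4 * M)) => [|k /=]; first by rewrite mulr_ge0.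
  by have [-> ] := rP k.
- apply/cvgrPdist_lt => e e0; apply: filterS (near_invS_lt e0) => k.
  by apply: lt_trans; case: (phiP k).
- apply: (@small _ M) => // k; rewrite dist_ge0 //=.
  by rewrite ler_pdivlMr ?ltr0n // mulrC.
Qed.

(** Along a subsequence with limit l the unit vectors (g x - p) / |g x - p| tend to
    a unit normal w0 to C at g l, and |v| <= (Lf + 2 M) / c tends to 0, Lf being a
    Lipschitz constant of f near l that bounds u. *)
Lemma bounded_critical_not_MFCQ (M fs K : R) (x_ : nat -> 'rV[R]_n) :
  (forall i, ~ feas (x_ i)) -> (forall i, penalty_critical M i (x_ i)) ->
  (forall i, i.+1%:R * dist C (g (x_ i)) <= M) ->
  (forall i, f (x_ i) <= fs) ->
  (forall N, exists2 i, (N <= i)%N & enorm (x_ i) <= K) ->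
  exists x, [/\ feas x, f x <= fs & ~ MFCQ g C x].
Proof.
move=> nS crit dM fb bnd.
have M0 : 0 <= M by apply: le_trans (dM 0%N); rewrite mul1r dist_ge0.
have /choice[phi phiP] : forall k : nat, exists i,
    (k <= i)%N /\ enorm (x_ i) <= K.
  by move=> k; have [i ? ?] := bnd k; exists i.
have /choice[q qP] : forall k : nat, exists q : R * R * 'rV[R]_m * 'rV[R]_n * 'rV[R]_n,
  let: (c, eps, p, u, v) := q in let x := x_ (phi k) in
  [/\ k.+1%:R <= c, 0 <= eps <= M, Defs.proj C (g x) p,
    subdiff f x u /\
      subdiff (scalarization g ((dist C (g x))^-1 *: (g x - p))) x v
  & enorm (u + c *: v) <= 2 * eps].
  move=> k; have [c [eps [p [u [v [ic [? _] ? ? ?]]]]]] := crit (phi k).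
  exists (c, eps, p, u, v); split => //; apply: le_trans ic.
  by rewrite ler_nat ltnS; case: (phiP k).
pose x k := x_ (phi k); pose p k := (q k).1.1.2; pose v k := (q k).2.
pose w k := (dist C (g (x k)))^-1 *: (g (x k) - p k).
have w1 k : enorm (w k) = 1.
  have d0 : 0 < dist C (g (x k)) := dist_gt0 (nS _).
  rewrite /w enormZ gtr0_norm ?invr_gt0 //.
  have : Defs.proj C (g (x k)) (p k).
    by rewrite /p; case: (q k) (qP k) => [[[[? ?] ?] ?] ?] [].
  by move=> [_ ->]; rewrite mulVf ?gt_eqF.
have xK k : enorm (x k) <= K by case: (phiP k).
have w1le k : enorm (w k) <= 1 by rewrite w1.
have [l [w0 [w0' lP]]] := bounded_cluster xK w1le w1le.
have near_l (e : R) : 0 < e -> exists k, [/\ k.+1%:R^-1 < e,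
    enorm (x k - l) < e & enorm (w k - w0) < e].
  by move=> e0; have [k [? ? ? _]] := lP _ e0; exists k.
have pk k : Defs.proj C (g (x k)) (p k).
  by rewrite /p; case: (q k) (qP k) => [[[[? ?] ?] ?] ?] [].
have [L [r [L0 r0 gL]]] := locally_lipschitz_enorm_vec g_lip l.
have ll : enorm (l - l) <= r by rewrite subrr enorm0 ltW.
have Sl : feas l.
  apply: closed_enorm C_closed _ => e e0.
  have d0 : 0 < Num.min r (e / (L + M)) by rewrite lt_min r0 divr_gt0 ?ltr_wpDr.
  have [k [kd xd _]] := near_l _ d0; exists (p k); first by case: (pk k).
  move: kd xd; rewrite !lt_min => /andP[_ ke] /andP[xr xe].
  have xgl := gL _ _ (ltW xr) ll.
  have dk : dist C (g (x k)) <= M * k.+1%:R^-1.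
    rewrite ler_pdivlMr ?ltr0n // mulrC; apply: le_trans (dM (phi k)).
    by rewrite ler_wpM2r ?dist_ge0 // ler_nat ltnS; case: (phiP k).
  have := ler_enorm_dist (g (x k)) (p k) (g l).
  rewrite (enormBC (p k) (g (x k))); case: (pk k) => _ ->.
  have : dist C (g (x k)) <= M * (e / (L + M)).
    by apply: le_trans dk _; rewrite ler_wpM2l // ltW.
  have : L * enorm (x k - l) < L * (e / (L + M)) by rewrite ltr_pM2l.
  have : L * (e / (L + M)) + M * (e / (L + M)) = e.
    by rewrite -mulrDl mulrC divfK // gt_eqF // ltr_wpDr.
  lra.
exists l; split=> //.
  apply/ler_addgt0Pr => e e0.
  have [d d0 fd] := continuous_enorm l (locally_lipschitz_continuous f_lip) e0.
  have [k [_ xd _]] := near_l _ d0.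
  by have := fd _ xd; have := fb (phi k); rewrite ltr_norml /x; lra.
apply; exists w0; split.
- apply/eqP; rewrite eq_le; apply/andP; split; apply/ler_addgt0Pr => e e0.
    have [k [_ _ wk]] := near_l _ e0.
    by have := ler_enorm_sub w0 (w k); rewrite enormBC w1; lra.
  have [k [_ _ wk]] := near_l _ e0.
  by have := ler_enorm_sub (w k) w0; rewrite w1; lra.
- split=> //; apply/LimsupP => e e0.
  have d0 : 0 < Num.min (Num.min r e) (e / L) by rewrite !lt_min r0 e0 divr_gt0.
  have [k [_]] := near_l _ d0; rewrite !lt_min => /andP[/andP[xr _] xe].
  move=> /andP[/andP[_ we] _].
  exists (g (x k)), (w k); split => //.
    apply: le_lt_trans (gL _ _ (ltW xr) ll) _.
    by rewrite mulrC -ltr_pdivlMr.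
  exists (dist C (g (x k)))^-1, (g (x k) - p k); split => //.
    by rewrite invr_ge0 dist_ge0.
  by exists (p k).
- apply: scalarization_subdiff_stable => // e e0.
  have [Lf [rf [Lf0 rf0 fL]]] := locally_lipschitz_enorm f_lip l.
  have d0 : 0 < Num.min (Num.min (rf / 2) e) (e / (Lf + 2 * M)).
    by rewrite !lt_min divr_gt0 // e0 divr_gt0 // ltr_wpDr // mulr_ge0.
  have [k [kd xd wd]] := near_l _ d0.
  move: kd xd wd; rewrite !lt_min => /andP[_ ke] /andP[/andP[xr xe] _].
  move=> /andP[/andP[_ we] _].
  exists (x k), (w k), (v k).
  have : exists c eps u, [/\ k.+1%:R <= c, 0 <= eps <= M, subdiff f (x k) u,
      subdiff (scalarization g (w k)) (x k) (v k) &
      enorm (u + c *: v k) <= 2 * eps].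
    rewrite /w /v /p; case: (q k) (qP k) => [[[[c eps] ?] u] ?] [? ? ? [? ?] ?].
    by exists c, eps, u.
  move=> [c [eps [u [kc /andP[_ epsM] fu gv uv]]]]; split => //.
  have k0 : 0 < k.+1%:R :> R by rewrite ltr0n.
  have c0 : 0 < c := lt_le_trans k0 kc.
  have uL : enorm u <= Lf.
    apply: (subdiff_le f_lip (ltW Lf0) _ _ fu (r := rf / 2)); first by lra.
    move=> z z' zx zx'; apply: fL.
      by have := ler_enorm_dist (x k) z l; lra.
    by have := ler_enorm_dist (x k) z' l; lra.
  have cv : c * enorm (v k) <= Lf + 2 * M.
    have := ler_enormB (u + c *: v k) u.
    by rewrite addrAC subrr add0r enormZ gtr0_norm //; lra.
  have kv : k.+1%:R * enorm (v k) <= Lf + 2 * M.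
    by apply: le_trans cv; rewrite ler_wpM2r ?enorm_ge0.
  rewrite subr0; move: kv; rewrite -ler_pdivlMl // => /le_lt_trans; apply.
  by rewrite -ltr_pdivlMr // ltr_wpDr // mulr_ge0.
Qed.

End ExactPenalty.

(** * Optimality condition at minimizers *)

Section Optimality.
Context {R : realType} {n m : nat}.
Variables (f : 'rV[R]_n -> R) (g : 'rV[R]_n -> 'rV[R]_m) (C : set 'rV[R]_m).
Hypotheses (f_lip : locally_lipschitz f) (g_lip : locally_lipschitz g).
Hypotheses (C_neq0 : C !=set0) (C_closed : closed C).

(** The objective is at least F_c(x0) + |z - x0|^2, and F_c(x0) + c del at z = x0,
    which places its minimizer within sqrt(c del) < eta of x0, inside the unit
    ball.  There |z - x0|^2 has slope at most 3 eta. *)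
Lemma smoothed_minimizer_stationary (c eta : R) x0 :
  0 < c -> C (g x0) -> (forall z, penalty f g C c x0 <= penalty f g C c z) ->
  0 < eta -> eta <= 1 / 2 ->
  exists x w u v, [/\ enorm (x - x0) < eta,
    conic_hull [set g x - p | p in Defs.proj C (g x)] w /\ enorm w <= 1,
    subdiff f x u, subdiff (scalarization g w) x v
  & enorm (u + c *: v) <= 6 * eta].
Proof.
move=> c0 Cx0 x0min eta0 eta12.
pose del := eta ^+ 2 / (2 * c).
have del0 : 0 < del by rewrite divr_gt0 ?exprn_gt0 ?mulr_gt0.
have cdel : c * del = eta ^+ 2 / 2 by rewrite /del; field; rewrite gt_eqF.
pose s z := Num.sqrt (dist C (g z) ^+ 2 + del ^+ 2).
have s0 z : 0 < s z by rewrite sqrtr_gt0 ltr_wpDl ?sqr_ge0 ?exprn_gt0.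
have sC : continuous s.
  move=> x; apply: (@continuous_comp _ _ _ (fun x => dist C (g x))
    (fun t => Num.sqrt (t ^+ 2 + del ^+ 2))); first exact: distg_continuous.
  apply: (@continuous_comp _ _ _ (fun t : R => t ^+ 2 + del ^+ 2)).
    by apply: cvgD; [exact: exprn_continuous | exact: cvg_cst].
  exact: sqrt_continuous.
pose h (z : 'rV[R]_n) := f z + c * s z + 1 * enorm (z - x0) ^+ 2.
have hC : continuous h.
  apply: continuous_addZ; first apply: continuous_addZ => //.
    exact: locally_lipschitz_continuous.
  move=> x; apply: (@continuous_comp _ _ _ (fun x : 'rV[R]_n => enorm (x - x0))
    (fun t => t ^+ 2)); first exact: enormB_continuous.
  exact: exprn_continuous.
pose K := [set z | enorm (z - x0) <= 1].
have Kc : compact K by exact: enorm_ball_compact.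
have Kx0 : K x0 by rewrite /K /= subrr enorm0.
have [||x /set_mem Kx xK] := @EVT_min_rV _ _ h K _ Kc.
- by exists x0.
- exact: continuous_subspaceT.
have xx0 : enorm (x - x0) < eta.
  rewrite -(@ltr_pXn2r _ 2) ?nnegrE ?enorm_ge0 ?(ltW eta0) //.
  have := xK _ (mem_set Kx0); have := x0min x.
  rewrite /h /penalty /s subrr enorm0 (dist_mem Cx0).
  rewrite [0 ^+ 2]expr2 mul0r add0r sqrtr_sqr (gtr0_norm del0) cdel.
  have : c * dist C (g x) <= c * s x.
    rewrite ler_pM2l // -[leLHS]ger0_norm ?dist_ge0 // -sqrtr_sqr ler_wsqrtr //.
    by rewrite lerDl sqr_ge0.
  rewrite -/(s x); have : 0 < eta ^+ 2 by rewrite exprn_gt0.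
  lra.
have [p pP] := proj_neq0 (g x) C_closed C_neq0.
have eps0 : 0 < 3 * eta by rewrite mulr_gt0.
have [|u [v [fu gv uv]]] := @smoothed_penalty_stationary _ _ _ f g C f_lip g_lip
    C_neq0 c (3 * eta) del x p c0 eps0 pP (s0 x).
  apply/nbhs_enormP; exists eta => // z zx.
  have xz := ler_enorm_dist x z x0.
  have Kz : K z by rewrite /K /=; lra.
  have := xK _ (mem_set Kz); rewrite /h !mul1r.
  have : (enorm (z - x0) - enorm (x - x0)) * (enorm (z - x0) + enorm (x - x0)) <=
      enorm (z - x) * (3 * eta).
    have := enorm_ge0 (z - x0); have := enorm_ge0 (x - x0).
    have := enorm_ge0 (z - x); nra.
  rewrite -/(s x) -/(s z); lra.
exists x, ((s x)^-1 *: (g x - p)), u, v; split => //; last lra.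
split; first by exists (s x)^-1, (g x - p); split;
  [rewrite invr_ge0 ltW | exists p |].
rewrite enormZ gtr0_norm ?invr_gt0 // ler_pdivrMl // mulr1.
case: pP => _ ->; rewrite -[leLHS]ger0_norm ?dist_ge0 // -sqrtr_sqr ler_wsqrtr //.
by rewrite lerDl sqr_ge0.
Qed.

Lemma penalty_minimizer_optimality (c : R) x0 :
  0 < c -> C (g x0) -> (forall z, penalty f g C c x0 <= penalty f g C c z) ->
  exists w, [/\ normal_cone C (g x0) w, enorm w <= 1
    & exists u v, [/\ subdiff f x0 u, subdiff (scalarization g w) x0 v
                    & 0 = u + c *: v]].
Proof.
move=> c0 Cx0 x0min.
have [Lf [rf [Lf0 rf0 fL]]] := locally_lipschitz_enorm f_lip x0.
have [L [r [L0 r0 gL]]] := locally_lipschitz_enorm_vec g_lip x0.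
pose eta (i : nat) := Num.min i.+1%:R^-1 (Num.min (1 / 2) (Num.min (rf / 2) r)) : R.
have etaP i : [/\ 0 < eta i, eta i <= i.+1%:R^-1, eta i <= 1 / 2,
    eta i <= rf / 2 & eta i <= r].
  by rewrite !lt_min !ge_min !lexx !orbT invr_gt0 ltr0n !divr_gt0.
have /choice[q qP] : forall i : nat,
    exists q : 'rV[R]_n * 'rV[R]_m * 'rV[R]_n * 'rV[R]_n,
    let: (x, w, u, v) := q in [/\ enorm (x - x0) < eta i,
    conic_hull [set g x - p | p in Defs.proj C (g x)] w /\ enorm w <= 1,
    subdiff f x u, subdiff (scalarization g w) x v
  & enorm (u + c *: v) <= 6 * eta i].
  move=> i; have [e0 _ e2 _ _] := etaP i.
  have [x [w [u [v H]]]] := smoothed_minimizer_stationary c0 Cx0 x0min e0 e2.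
  by exists (x, w, u, v).
pose x i := (q i).1.1.1; pose w i := (q i).1.1.2.
pose u i := (q i).1.2; pose v i := (q i).2.
have {}qP i : [/\ enorm (x i - x0) < eta i,
    conic_hull [set g (x i) - p | p in Defs.proj C (g (x i))] (w i) /\ enorm (w i) <= 1,
    subdiff f (x i) (u i), subdiff (scalarization g (w i)) (x i) (v i)
  & enorm (u i + c *: v i) <= 6 * eta i].
  by rewrite /x /w /u /v; case: (q i) (qP i) => [[[? ?] ?] ?].
have w1 i : enorm (w i) <= 1 by case: (qP i) => _ [].
have uL i : enorm (u i) <= Lf.
  have [_ _ _ er _] := etaP i; have [xi _ fu _ _] := qP i.
  apply: (subdiff_le f_lip (ltW Lf0) _ _ fu (r := rf / 2)); first by lra.
  move=> z z' zx zx'; apply: fL.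
    by have := ler_enorm_dist (x i) z x0; lra.
  by have := ler_enorm_dist (x i) z' x0; lra.
have vL i : enorm (v i) <= (Lf + 3) / c.
  have [_ _ e2 _ _] := etaP i; have [_ _ _ _ uv] := qP i.
  rewrite ler_pdivlMr // mulrC; have := ler_enormB (u i + c *: v i) (u i).
  by rewrite addrAC subrr add0r enormZ gtr0_norm //; have := uL i; lra.
have [w0 [u0 [v0 lP]]] := bounded_cluster w1 uL vL.
have lim (e : R) : 0 < e -> exists i, [/\ eta i < e, enorm (w i - w0) < e,
    enorm (u i - u0) < e & enorm (v i - v0) < e].
  move=> e0; have [i [ie ? ? ?]] := lP _ e0; exists i; split => //.
  by have [_ ei _ _ _] := etaP i; exact: le_lt_trans ei ie.
exists w0; split.
- split=> //; apply/LimsupP => e e0.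
  have d0 : 0 < Num.min e (e / L) by rewrite lt_min e0 divr_gt0.
  have [i [ei wi _ _]] := lim _ d0; have [_ _ _ _ er] := etaP i.
  move: ei wi; rewrite !lt_min => /andP[_ ei] /andP[wi _].
  have [xi [wc _] _ _ _] := qP i; exists (g (x i)), (w i); split => //.
  apply: le_lt_trans (gL _ _ _ _) _; first by lra.
    by rewrite subrr enorm0 ltW.
  by rewrite mulrC -ltr_pdivlMr // (lt_trans xi).
- apply/ler_addgt0Pr => e e0; have [i [_ wi _ _]] := lim _ e0.
  by have := ler_enorm_sub w0 (w i); rewrite enormBC; have := w1 i; lra.
exists u0, v0; split.
- apply: subdiff_closed => // e e0; have [i [ei _ ui _]] := lim _ e0.
  have [xi _ fu _ _] := qP i; exists (x i), (u i); split => //.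
  exact: lt_trans ei.
- apply: scalarization_subdiff_stable => // e e0.
  have [i [ei wi _ vi]] := lim _ e0; have [xi _ _ gv _] := qP i.
  by exists (x i), (w i), (v i); split => //; exact: lt_trans ei.
apply/esym/enorm0_eq0/eqP; rewrite eq_le enorm_ge0 andbT.
apply: (@ler_addMeps _ _ _ (7 + c)) => [|e e0]; first by rewrite addr_ge0 // ltW.
have [i [ei _ ui vi]] := lim _ e0; have [_ _ _ _ uv] := qP i.
have -> : u0 + c *: v0 = (u i + c *: v i) - ((u i - u0) + c *: (v i - v0)).
  by rewrite scalerBr addrACA -opprD subKr.
apply: le_trans (ler_enormB _ _) _.
have := ler_enormD (u i - u0) (c *: (v i - v0)).
rewrite enormZ gtr0_norm //.
have : c * enorm (v i - v0) <= c * e by rewrite ler_pM2l // ltW.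
lra.
Qed.

End Optimality.

(** * The theorem *)

Theorem theorem4p1 (R : realType) (n m : nat)
    (f : 'rV[R]_n -> R) (g : 'rV[R]_n -> 'rV[R]_m) (C : set 'rV[R]_m)
    (f_lip : locally_lipschitz f) (g_lip : locally_lipschitz g)
    (C_neq0 : C !=set0) (C_closed : closed C)
    (S_neq0 : feasible g C !=set0)
    (fstar_fin : infval (feasible g C) f \is a fin_num)
    (A1 : forall x, argmin (feasible g C) f x -> MFCQ g C x)
    (A2 : K_infty f g C `<=` [set t | (infval (feasible g C) f < t%:E)%E]) :
  let exact_value :=
    \forall c \near +oo%R,
      infval (feasible g C) f = infval setT (penalty f g C c) in
  let bounded_penalty :=
    exists2 cs : R, 0 < cs & (-oo < infval setT (penalty f g C cs))%E in
  (exact_value <-> bounded_penalty) /\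
  (bounded_penalty ->
    (exists cs : R, penalty_threshold f g C cs) /\
    (forall cs : R, penalty_threshold f g C cs ->
      forall c : R, cs < c ->
        argmin (feasible g C) f = argmin setT (penalty f g C c) /\
        (forall xbar, argmin (feasible g C) f xbar ->
          exists w, [/\ normal_cone C (g xbar) w, enorm w <= 1
            & exists u v, [/\ subdiff f xbar u,
                subdiff (scalarization g w) xbar v & 0 = u + c *: v]]))).
Proof.
move=> exact_value bounded_penalty.
set S := feasible g C in S_neq0 fstar_fin A1 A2 exact_value *.
pose P := penalty f g C.
have [fs fsE] : exists fs : R, infval S f = fs%:E.
  by exists (fine (infval S f)); rewrite fineK.
have fsP x : S x -> fs <= f x.
  by move=> Sx; rewrite -lee_fin -fsE; apply: ereal_inf_lbound; exists x.
have PS c x : S x -> P c x = f x by exact: penalty_feasible.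
have infP c : (infval setT (P c) <= fs%:E)%E.
  rewrite -fsE; apply: le_ereal_inf_tmp => _ [x Sx <-].
  by apply: ereal_inf_lbound; exists x => //; rewrite PS.
have exactP c : infval S f = infval setT (P c) <-> forall x, fs <= P c x.
  rewrite fsE; split=> [E x|H].
    by rewrite -lee_fin E; apply: ereal_inf_lbound; exists x.
  apply/eqP; rewrite eq_le; apply/andP; split; last exact: infP.
  by apply: le_ereal_inf_tmp => _ [x _ <-]; rewrite lee_fin.
have Pmono c c' x : c <= c' -> P c x <= P c' x.
  by move=> cc; rewrite lerD2l ler_wpM2r // dist_ge0.
have exact_of c1 : (forall x, fs <= P c1 x) -> exact_value.
  move=> H; exists c1; split; first exact: num_real.
  by move=> c /ltW cc; apply/exactP => x; exact: le_trans (Pmono _ _ _ cc).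
have bounded_exact : bounded_penalty -> exists c1, forall x, fs <= P c1 x.
  move=> [cs cs0 csb]; apply: contrapT => /forallNP H.
  have [B BP] : exists B, forall x, B <= P cs x.
    exists (fine (infval setT (P cs))) => x; rewrite -lee_fin fineK.
      by apply: ereal_inf_lbound; exists x.
    by apply/fin_real; rewrite csb (le_lt_trans (infP cs)) // ltry.
  have /choice[x_ x_P] : forall i : nat, exists x, [/\ ~ S x, P (cs + i.+1%:R) x < fs
      & penalty_critical f g C (fs - B) i x].
    move=> i; have /existsNP[a /negP] := H (cs + i.+1%:R); rewrite -ltNge => aP.
    apply: penalty_critical_exists aP => //.
      move=> z; apply: le_trans (BP z) (Pmono _ _ _ _).
      by rewrite lerDl.
    by rewrite lerDr ltW.
  pose M := fs - B.
  have dM i : i.+1%:R * dist C (g (x_ i)) <= M.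
    have [_ + _] := x_P i; have := BP (x_ i); rewrite /P /penalty /M; lra.
  have d0 i : 0 <= dist C (g (x_ i)) by exact: dist_ge0.
  have f_up i : f (x_ i) <= fs.
    have [_ /ltW + _] := x_P i; apply: le_trans.
    by rewrite lerDl mulr_ge0 // addr_ge0 // ltW.
  have f_lo i : B - cs * M <= f (x_ i).
    have := BP (x_ i); rewrite /P /penalty.
    have : cs * dist C (g (x_ i)) <= cs * M.
      rewrite ler_pM2l //; apply: le_trans (dM i).
      by rewrite ler_peMl // ler1n.
    lra.
  have nS i : ~ S (x_ i) by case: (x_P i).
  have crit i : penalty_critical f g C M i (x_ i) by case: (x_P i).
  (* either the whole sequence escapes to infinity, or a subsequence is bounded *)
  have [unb|] := pselect (forall K, exists N, forall i, (N <= i)%N ->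
      K <= enorm (x_ i)).
    have [|t /A2 /= + tfs] := unbounded_critical_K_infty C_neq0 nS crit dM _ unb
      (b1 := B - cs * M) (b2 := fs).
      by move=> i; rewrite f_lo f_up.
    by rewrite fsE lte_fin ltNge tfs.
  move=> /existsNP[K /forallNP bnd].
  have [|x [Sx xfs]] := bounded_critical_not_MFCQ f_lip g_lip C_neq0 C_closed nS crit
    dM f_up (K := K).
    move=> N; have /existsNP[i /not_implyP[Ni /negP]] := bnd N.
    by rewrite -ltNge => /ltW; exists i.
  apply; apply: A1; split=> // y Sy; exact: le_trans xfs (fsP _ Sy).
have exact_bounded : exact_value -> bounded_penalty.
  move=> H.
  have [c [c0 /exactP cE]] := filter_ex (filterI (nbhs_pinfty_gt (num_real 0)) H).
  exists c => //; apply: lt_le_trans (_ : (fs%:E <= _)%E); first exact: ltNyr.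
  by apply: le_ereal_inf_tmp => _ [x _ <-]; rewrite lee_fin.
split; first by split => // /bounded_exact[c1 /exact_of].
move=> bp; split.
  have [c1 c1P] := bounded_exact bp.
  have c1le : c1 <= Num.max c1 1 by rewrite le_max lexx.
  exists (Num.max c1 1); split.
  - by rewrite lt_max ltr01 orbT.
  - apply: lt_le_trans (_ : (fs%:E <= _)%E); first exact: ltNyr.
    apply: le_ereal_inf_tmp => _ [x _ <-]; rewrite lee_fin.
    exact: le_trans (Pmono _ _ _ c1le).
  - move=> c /ltW cc; apply/exactP => x.
    exact: le_trans (c1P x) (Pmono _ _ _ (le_trans c1le cc)).
move=> cs [cs0 _ csE] c csc.
have Pfs c' : cs < c' -> forall x, fs <= P c' x by move=> /csE/exactP.
have fs_attained x : argmin S f x -> f x = fs.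
  move=> [Sx xmin]; apply/eqP; rewrite eq_le (fsP _ Sx) andbT -lee_fin -fsE.
  by apply: le_ereal_inf_tmp => _ [y Sy <-]; rewrite lee_fin xmin.
have argminP x : argmin S f x -> forall z, P c x <= P c z.
  by move=> xm z; rewrite PS ?fs_attained ?Pfs //; case: xm.
split.
  apply/seteqP; split=> [x xm|x [_ xm]]; first by split => // y _; exact: argminP.
  have Pcx : P c x <= fs.
    rewrite -lee_fin -fsE; apply: le_ereal_inf_tmp => _ [y Sy <-].
    by rewrite lee_fin -(PS c y Sy); exact: xm.
  have Sx : S x.
    apply: (@dist_eq0 _ _ C (g x)) => //.
    apply/eqP; rewrite eq_le (dist_ge0 _ C_neq0) andbT.
    (* equality of the values at a parameter strictly below c leaves no room for
       a positive distance *)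
    have mid : cs < (cs + c) / 2 by lra.
    have := Pfs _ mid x; move: Pcx; rewrite /P /penalty => H1 H2.
    have : (c - cs) * dist C (g x) <= 0 by lra.
    by rewrite pmulr_rle0 // subr_gt0.
  split=> // y Sy; rewrite -(PS c x Sx); exact: le_trans Pcx (fsP _ Sy).
move=> xbar xm.
apply: penalty_minimizer_optimality => //; first exact: lt_trans csc.
- by case: xm.
- exact: argminP.
Qed.
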